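(* Given a string $S[1..n]$ over $[1..\sigma]$ and an integer $k\geq 1$, a minimum $k$-attractor of $S$ can be found in $\mathcal O(n)+\exp\big(\mathcal O(\sigma^k\log\sigma^k)\big)$ time.
   Context: A set $\Gamma\subseteq[1..n]$ is a $k$-attractor of $S$ if every substring $S[i..j]$ with $i\leq j<i+k$ has an occurrence $S[i'..j']=S[i..j]$ with $j''\in[i'..j']$ for some $j''\in\Gamma$. A minimum $k$-attractor is a $k$-attractor of smallest cardinality. Model: word RAM with words of $\Theta(\log n)$ bits. *)

(* Defs.v *)
From mathcomp Require Import all_boot all_order all_algebra.
From mathcomp Require Import finmap.

Set Implicit Arguments.
Unset Strict Implicit.
Unset Printing Implicit Defensive.

(* Positions are 1-based: substr S i j is S[i..j], for 1 <= i <= j <= size S. *)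
Definition substr (S : seq nat) (i j : nat) : seq nat := drop i.-1 (take j S).

Definition is_attractor (k : nat) (S : seq nat) (G : {fset nat}) : Prop :=
  (forall p, p \in G -> 1 <= p <= size S) /\
  (forall i j, 1 <= i -> i <= j -> j <= size S -> j < i + k ->
     exists i' j', [/\ 1 <= i' <= j', j' <= size S,
                       substr S i' j' = substr S i j
                     & exists2 p, p \in G & i' <= p <= j']).

Definition is_min_attractor (k : nat) (S : seq nat) (G : {fset nat}) : Prop :=
  is_attractor k S G /\
  forall G', is_attractor k S G' -> (#|` G| <= #|` G'|)%N.

(* Word RAM with w-bit words: unit-cost instructions, arithmetic modulo 2 ^ w,
   and a memory of 2 ^ w words (an address is the content of a register). A
   program is a finite list of instructions, so it uses boundedly many
   registers. *)
Inductive binop : Set :=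
  | Add | Sub | Mul | Div | Mod | And | Or | Xor | Shl | Shr.

Definition eval_binop (w : nat) (o : binop) (x y : nat) : nat :=
  (match o with
   | Add => x + y
   | Sub => x + (2 ^ w - y)
   | Mul => x * y
   | Div => x %/ y
   | Mod => x %% y
   | And => Nat.land x y
   | Or => Nat.lor x y
   | Xor => Nat.lxor x y
   | Shl => x * 2 ^ y
   | Shr => x %/ 2 ^ y
   end) %% 2 ^ w.

Inductive instr : Set :=
  | Const of nat & nat           (* r := c *)
  | Move of nat & nat            (* r := r1 *)
  | Op of binop & nat & nat & nat (* r := r1 op r2 *)
  | Read of nat & nat            (* r := cell[r1] *)
  | Write of nat & nat           (* cell[r] := r1 *)
  | Jump of nat                  (* goto l *)
  | JumpEq of nat & nat & nat    (* if r1 = r2 goto l *)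
  | JumpLt of nat & nat & nat.   (* if r1 < r2 goto l *)

Definition program := seq instr.

Record state : Type := State { pc : nat; reg : nat -> nat; cell : nat -> nat }.

Definition upd (f : nat -> nat) (x v : nat) : nat -> nat :=
  fun y => if y == x then v else f y.

Definition exec (w : nat) (c : instr) (s : state) : state :=
  let: State l g m := s in
  match c with
  | Const r v => State l.+1 (upd g r (v %% 2 ^ w)) m
  | Move r r1 => State l.+1 (upd g r (g r1)) m
  | Op o r r1 r2 => State l.+1 (upd g r (eval_binop w o (g r1) (g r2))) m
  | Read r r1 => State l.+1 (upd g r (m (g r1))) m
  | Write r r1 => State l.+1 g (upd m (g r) (g r1))
  | Jump l' => State l' g m
  | JumpEq r1 r2 l' => State (if g r1 == g r2 then l' else l.+1) g m
  | JumpLt r1 r2 l' => State (if g r1 < g r2 then l' else l.+1) g m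
  end.

(* A computation halts by leaving the program text. *)
Definition halted (P : program) (s : state) : bool := size P <= pc s.

Definition step (w : nat) (P : program) (s : state) : state :=
  if halted P s then s else exec w (nth (Jump 0) P (pc s)) s.

(* Input convention: registers 0, 1, 2 hold n, sigma, k, and S[1], ..., S[n] are
   in cells 0, ..., n - 1; all other registers and cells are 0. *)
Definition init (sigma k : nat) (S : seq nat) : state :=
  State 0 (nth 0 [:: size S; sigma; k]) (nth 0 S).

(* Output convention: register 0 holds the number of elements and register 1
   the address of the first one. *)
Definition output (s : state) : seq nat :=
  [seq cell s (reg s 1 + i) | i <- iota 0 (reg s 0)].

(* P computes, in at most t steps, a minimum k-attractor of S, listed
   without repetition. *)
Definition finds_min_attractor (w : nat) (P : program) (sigma k : nat)
    (S : seq nat) (t : nat) : Prop :=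
  let s := iter t (step w P) (init sigma k S) in
  [/\ halted P s, uniq (output s)
    & is_min_attractor k S [fset p in output s]%fset].

(* Main.v *)
(** Cut every position [p] down to its context [S[p-k+1..p+k-1]]: two positions with
    the same context cover the same substrings of length at most [k], so one position per
    context is enough, and the substrings around these representatives are all the
    substrings to be covered. With [N = sigma ^ k] there are at most [N ^ 4] contexts.
    They are read off in linear time from a rolling base-[sigma + 1] code, which fits in a
    word when [N <= n]; when [n < N] every position is kept. As there are at most [2 N]
    distinct substrings of length at most [k], some attractor has at most [2 N] elements,
    and a shortest one is found by testing the sequences of representatives by increasing
    length: [N ^ O(N)] sequences, each tested in time polynomial in [N]. A unary string has
    the attractor [{1}]. *)

Require Import Defs.
From mathcomp Require Import all_boot all_order all_algebra.
From mathcomp Require Import finmap zify reals sequences exp.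

Set Implicit Arguments.
Unset Strict Implicit.
Unset Printing Implicit Defensive.

(** * A structured language over the word RAM *)

(** The running time is a sum, so the search must not depend on [n]: a candidate is tested only on
    the windows through representatives, compared in place in the input. Before that, a repeated
    context has to be recognised in constant time. Its code serves as an address in a table of up to
    [N ^ 4] cells, too many to initialise in linear time, but the memory starts at 0. The code also
    has to fit in a word, whence the distinction: if [N <= n], then [N ^ 4] is polynomial in [n],
    and words of seven times the length of [n] have room for it; if [n < N], keeping all positions
    costs only a polynomial in [N]. Candidates are numbered in bijective numeration, with digits
    from 1 to [q]: a sequence has exactly one number, shorter sequences have smaller numbers, and a
    0 in memory lies past the last digit. Since the machine computes modulo [2 ^ w], the commands
    are verified over natural numbers under side conditions that exclude overflow, and running times
    are bounded from the syntax. *)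

Inductive expr : Set :=
  | Var of nat
  | Cst of nat
  | Bin of binop & expr & expr
  | Fetch of expr.

Inductive cmd : Set :=
  | Skip
  | Assign of nat & expr
  | Store of expr & expr
  | Then of cmd & cmd
  | IfLt of expr & expr & cmd & cmd
  | WhileLt of expr & expr & cmd.

(* Variables are the registers below [tmp]; the others hold intermediate values. *)
Definition tmp : nat := 40.

Fixpoint compile_expr (e : expr) (r : nat) : seq instr :=
  match e with
  | Var x => [:: Move r x]
  | Cst c => [:: Const r c]
  | Bin o a b => compile_expr a r ++ compile_expr b r.+1 ++ [:: Op o r r r.+1]
  | Fetch a => compile_expr a r ++ [:: Read r r]
  end.

Definition compile_pair (a b : expr) : seq instr :=
  compile_expr a tmp ++ compile_expr b tmp.+1.

(* Jumps are absolute: [l] is the address at which the code is placed. *)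
Fixpoint compile (l : nat) (c : cmd) : seq instr :=
  match c with
  | Skip => [::]
  | Assign x e => compile_expr e tmp ++ [:: Move x tmp]
  | Store a e => compile_pair a e ++ [:: Write tmp tmp.+1]
  | Then c1 c2 => compile l c1 ++ compile (l + size (compile l c1)) c2
  | IfLt a b c1 c2 =>
      let h := compile_pair a b in
      let p2 := compile (l + size h).+1 c2 in
      let l1 := ((l + size h).+1 + size p2).+1 in
      let p1 := compile l1 c1 in
      h ++ JumpLt tmp tmp.+1 l1 :: p2 ++ Jump (l1 + size p1) :: p1
  | WhileLt a b c =>
      let h := compile_pair a b in
      let l1 := (l + size h).+2 in
      let p := compile l1 c in
      h ++ JumpLt tmp tmp.+1 l1 :: Jump (l1 + size p).+1 :: p ++ [:: Jump l]
  end.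

Fixpoint vars_lt (b : nat) (e : expr) : bool :=
  match e with
  | Var x => x < b
  | Cst _ => true
  | Bin _ a c => vars_lt b a && vars_lt b c
  | Fetch a => vars_lt b a
  end.

Fixpoint wf (c : cmd) : bool :=
  match c with
  | Skip => true
  | Assign x e => (x < tmp) && vars_lt tmp e
  | Store a e => vars_lt tmp a && vars_lt tmp e
  | Then c1 c2 => wf c1 && wf c2
  | IfLt a b c1 c2 => [&& vars_lt tmp a, vars_lt tmp b, wf c1 & wf c2]
  | WhileLt a b c => [&& vars_lt tmp a, vars_lt tmp b & wf c]
  end.

Fixpoint writes (c : cmd) : seq nat :=
  match c with
  | Assign x _ => [:: x]
  | Then c1 c2 | IfLt _ _ c1 c2 => writes c1 ++ writes c2
  | WhileLt _ _ c => writes c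
  | _ => [::]
  end.

Fixpoint nostore (c : cmd) : bool :=
  match c with
  | Store _ _ => false
  | Then c1 c2 | IfLt _ _ c1 c2 => nostore c1 && nostore c2
  | WhileLt _ _ c => nostore c
  | _ => true
  end.

(* Unlike [x \in s], this unfolds by simplification on literals. *)
Definition inb (x : nat) (s : seq nat) : bool := has (Nat.eqb x) s.

Lemma inb_cat x s1 s2 : inb x (s1 ++ s2) = inb x s1 || inb x s2.
Proof. exact: has_cat. Qed.

Lemma Nat_eqbE (x y : nat) : Nat.eqb x y = (x == y).
Proof. by apply/idP/eqP => [/PeanoNat.Nat.eqb_eq|/PeanoNat.Nat.eqb_eq]. Qed.

Fixpoint ecost (e : expr) : nat :=
  match e with
  | Bin _ a b => (ecost a + ecost b).+1
  | Fetch a => (ecost a).+1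
  | _ => 1
  end.

Lemma size_compile_expr e r : size (compile_expr e r) = ecost e.
Proof.
by elim: e r => //= [o a IHa b IHb|a IHa] r; rewrite !size_cat ?IHa ?IHb /= ; lia.
Qed.

Lemma size_compile_pair a b : size (compile_pair a b) = ecost a + ecost b.
Proof. by rewrite size_cat !size_compile_expr. Qed.

(* An upper bound on the running time when every loop is iterated at most [X] times. *)
Fixpoint cost (X : nat) (c : cmd) : nat :=
  match c with
  | Skip => 0
  | Assign _ e => (ecost e).+1
  | Store a e => (ecost a + ecost e).+1
  | Then c1 c2 => cost X c1 + cost X c2
  | IfLt a b c1 c2 => (ecost a + ecost b).+2 + (cost X c1 + cost X c2)
  | WhileLt a b c => X.+1 * ((ecost a + ecost b).+2 + cost X c)
  end.

Fixpoint csize (c : cmd) : nat :=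
  match c with
  | Skip => 0
  | Assign _ e => (ecost e).+1
  | Store a e => (ecost a + ecost e).+1
  | Then c1 c2 => csize c1 + csize c2
  | IfLt a b c1 c2 => (ecost a + ecost b).+2 + (csize c1 + csize c2)
  | WhileLt a b c => (ecost a + ecost b).+2 + csize c
  end.

Fixpoint depth (c : cmd) : nat :=
  match c with
  | Then c1 c2 | IfLt _ _ c1 c2 => maxn (depth c1) (depth c2)
  | WhileLt _ _ c => (depth c).+1
  | _ => 0
  end.

(** Only nesting multiplies iteration counts. For a concrete command both [csize] and [depth] are
    numerals obtained by computation. *)
Lemma cost_le X c : cost X c <= csize c * X.+1 ^ depth c.
Proof.
elim: c => //= [x e|a e|c1 IH1 c2 IH2|a b c1 IH1 c2 IH2|a b c IH].
- by rewrite expn0 muln1.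
- by rewrite expn0 muln1.
- rewrite mulnDl; apply: leq_add; [apply: leq_trans IH1 _|apply: leq_trans IH2 _];
  by rewrite leq_mul2l leq_pexp2l ?orbT // ?leq_maxl ?leq_maxr.
- rewrite 2!mulnDl; apply: leq_add; first by rewrite leq_pmulr // expn_gt0.
  apply: leq_add; [apply: leq_trans IH1 _|apply: leq_trans IH2 _];
  by rewrite leq_mul2l leq_pexp2l ?orbT // ?leq_maxl ?leq_maxr.
- rewrite expnS mulnCA leq_mul2l /= mulnDl; apply: leq_add => //.
  by rewrite leq_pmulr // expn_gt0.
Qed.

Lemma compile_if l a b c1 c2 :
  let l2 := (l + (ecost a + ecost b)).+1 in
  let l1 := (l2 + size (compile l2 c2)).+1 in
  compile l (IfLt a b c1 c2) =
    compile_pair a b ++ JumpLt tmp tmp.+1 l1 ::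
    compile l2 c2 ++ Jump (l1 + size (compile l1 c1)) :: compile l1 c1.
Proof. by move=> l2 l1; rewrite /l1 /l2 -size_compile_pair. Qed.

Lemma compile_while l a b c :
  let l1 := (l + (ecost a + ecost b)).+2 in
  compile l (WhileLt a b c) =
    compile_pair a b ++ JumpLt tmp tmp.+1 l1 ::
    Jump (l1 + size (compile l1 c)).+1 :: compile l1 c ++ [:: Jump l].
Proof. by move=> l1; rewrite /l1 -size_compile_pair. Qed.

(** * Total correctness of compiled code, with time bounds *)

Definition code_at (P : program) (l : nat) (p : seq instr) : Prop :=
  exists p1 p2, P = p1 ++ p ++ p2 /\ size p1 = l.

Lemma code_at_cat P l p q :
  code_at P l (p ++ q) -> code_at P l p /\ code_at P (l + size p) q.
Proof.
case=> p1 [p2 [-> <-]]; split.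
  by exists p1, (q ++ p2); rewrite -!catA.
by exists (p1 ++ p), p2; rewrite size_cat -!catA.
Qed.

Lemma code_at_cons P l i q :
  code_at P l (i :: q) -> code_at P l [:: i] /\ code_at P l.+1 q.
Proof. by rewrite -cat1s => /code_at_cat; rewrite addn1. Qed.

Section Wp.

Variable w : nat.

Lemma stepE P l i g m :
  code_at P l [:: i] -> step w P (State l g m) = exec w i (State l g m).
Proof.
case=> p1 [p2 [-> <-]]; rewrite /step /halted /= !size_cat /=.
rewrite ifF; last by lia.
by rewrite nth_cat ltnn subnn.
Qed.

Fixpoint eval (g m : nat -> nat) (e : expr) : nat :=
  match e with
  | Var x => g x
  | Cst c => c %% 2 ^ w
  | Bin o a b => eval_binop w o (eval g m a) (eval g m b)
  | Fetch a => m (eval g m a)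
  end.

Lemma eval_ext b g g' m e :
  vars_lt b e -> (forall x, x < b -> g' x = g x) -> eval g' m e = eval g m e.
Proof.
by move=> + gg'; elim: e => //= [o a IHa c IHc /andP[/IHa-> /IHc->]|a IHa /IHa->].
Qed.

(** The registers from [r] on act as a stack: the second operand is computed above the value of the
    first and leaves it intact. *)
Lemma compile_exprP e r P l g m :
  vars_lt r e -> code_at P l (compile_expr e r) ->
  exists g', [/\ iter (ecost e) (step w P) (State l g m) = State (l + ecost e) g' m,
    g' r = eval g m e & forall x, x < r -> g' x = g x].
Proof.
elim: e r l g => [y|c|o a IHa b IHb|a IHa] r l g /=.
- move=> _ /stepE ->; exists (upd g r (g y)); rewrite addn1; split => //.
    by rewrite /upd eqxx.
  by move=> x xr; rewrite /upd ltn_eqF.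
- move=> _ /stepE ->; exists (upd g r (c %% 2 ^ w)); rewrite addn1; split => //.
    by rewrite /upd eqxx.
  by move=> x xr; rewrite /upd ltn_eqF.
- case/andP=> va vb /code_at_cat[Ca /code_at_cat[Cb Co]].
  rewrite !size_compile_expr in Cb Co.
  have [g1 [E1 V1 F1]] := IHa _ _ g va Ca.
  have vb' : vars_lt r.+1 b.
    by elim: b vb {IHb Cb Co} => //= [x|o' b1 I1 b2 I2 /andP[/I1-> /I2->] //]; lia.
  have [g2 [E2 V2 F2]] := IHb _ _ g1 vb' Cb.
  exists (upd g2 r (eval_binop w o (g2 r) (g2 r.+1))); split.
  + by rewrite [ecost a + _]addnC iterD E1 E2 (stepE _ _ Co) /=; congr State; lia.
  + by rewrite /upd eqxx F2 // V1 V2 (eval_ext _ vb F1).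
  + by move=> x xr; rewrite /upd ltn_eqF // F2 ?F1 // ltnW.
- move=> va /code_at_cat[Ca Co]; rewrite size_compile_expr in Co.
  have [g1 [E1 V1 F1]] := IHa _ _ g va Ca.
  exists (upd g1 r (m (g1 r))); split.
  + by rewrite E1 (stepE _ _ Co) /= addnS.
  + by rewrite /upd eqxx V1.
  + by move=> x xr; rewrite /upd ltn_eqF // F1.
Qed.

Lemma vars_ltW b b' e : b <= b' -> vars_lt b e -> vars_lt b' e.
Proof.
by move=> bb'; elim: e => //= [x|o a IHa c IHc /andP[/IHa-> /IHc->] //]; lia.
Qed.

Lemma compile_pairP a b P l g m :
  vars_lt tmp a -> vars_lt tmp b -> code_at P l (compile_pair a b) ->
  exists g', [/\ iter (ecost a + ecost b) (step w P) (State l g m) =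
      State (l + (ecost a + ecost b)) g' m,
    g' tmp = eval g m a, g' tmp.+1 = eval g m b & forall x, x < tmp -> g' x = g x].
Proof.
move=> va vb /code_at_cat[Ca Cb]; rewrite size_compile_expr in Cb.
have [g1 [E1 V1 F1]] := compile_exprP g m va Ca.
have [g2 [E2 V2 F2]] := compile_exprP g1 m (vars_ltW (leqnSn _) vb) Cb.
exists g2; split.
- by rewrite addnC iterD E1 E2 -addnA [ecost b + _]addnC.
- by rewrite F2.
- by rewrite V2 (eval_ext _ vb F1).
- by move=> x xt; rewrite F2 ?F1 // ltnW.
Qed.

(* The postcondition is strengthened by the frame: variables that [c] does not
   assign, and the memory when [c] does not store. *)
Definition wp (c : cmd) (T : nat) (Q : (nat -> nat) -> (nat -> nat) -> Prop)
    (g m : nat -> nat) : Prop :=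
  wf c -> forall P l, code_at P l (compile l c) ->
  exists t g' m', [/\ t <= T,
    iter t (step w P) (State l g m) = State (l + size (compile l c)) g' m',
    forall x, x < tmp -> ~~ inb x (writes c) -> g' x = g x,
    nostore c -> m' = m & Q g' m'].

Lemma wp_weaken c T T' (Q Q' : _ -> _ -> Prop) g m :
  wp c T Q g m -> T <= T' ->
  (forall g' m', (forall x, x < tmp -> ~~ inb x (writes c) -> g' x = g x) ->
     (nostore c -> m' = m) -> Q g' m' -> Q' g' m') ->
  wp c T' Q' g m.
Proof.
move=> H TT' QQ' wfc P l /(H wfc)[t [g' [m' [tT E F N q]]]].
by exists t, g', m'; split; rewrite ?(leq_trans tT) //; apply: QQ'.
Qed.

Lemma wp_post c T (Q Q' : _ -> _ -> Prop) g m :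
  wp c T Q g m -> (forall g' m', Q g' m' -> Q' g' m') -> wp c T Q' g m.
Proof. by move=> H QQ'; apply: wp_weaken H _ _ => // g' m' _ _; apply: QQ'. Qed.

Lemma wp_skip (Q : _ -> _ -> Prop) g m : Q g m -> wp Skip 0 Q g m.
Proof. by move=> q _ P l _; exists 0, g, m; rewrite addn0. Qed.

Lemma wp_assign x e (Q : _ -> _ -> Prop) g m :
  (forall g', x < tmp -> g' x = eval g m e -> (forall y, y < tmp -> y != x -> g' y = g y) ->
     Q g' m) ->
  wp (Assign x e) (ecost e).+1 Q g m.
Proof.
move=> q /= /andP[xt ve] P l /code_at_cat[Ce Cm]; rewrite size_compile_expr in Cm.
have [g1 [E1 V1 F1]] := compile_exprP g m ve Ce.
exists (ecost e).+1, (upd g1 x (g1 tmp)), m; split => //.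
- by rewrite iterS E1 (stepE _ _ Cm) /= size_cat size_compile_expr addnA addn1.
- by move=> y yt; rewrite /inb /= orbF Nat_eqbE /upd => /negPf ->; apply: F1.
- apply: q => [//||y yt yx]; first by rewrite /upd eqxx.
  by rewrite /upd (negPf yx) F1.
Qed.

Lemma wp_store a e (Q : _ -> _ -> Prop) g m :
  (forall g', (forall y, y < tmp -> g' y = g y) ->
     Q g' (upd m (eval g m a) (eval g m e))) ->
  wp (Store a e) (ecost a + ecost e).+1 Q g m.
Proof.
move=> q /= /andP[va ve] P l /code_at_cat[Ce Cm]; rewrite size_compile_pair in Cm.
have [g1 [E1 V1 V2 F1]] := compile_pairP g m va ve Ce.
exists (ecost a + ecost e).+1, g1, (upd m (g1 tmp) (g1 tmp.+1)); split => //.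
- by rewrite iterS E1 (stepE _ _ Cm) /= size_cat size_compile_pair addn1 addnS.
- by move=> y yt _; apply: F1.
- by rewrite V1 V2; apply: q.
Qed.

Lemma wp_then c1 c2 T1 T2 Q g m :
  wp c1 T1 (wp c2 T2 Q) g m -> wp (Then c1 c2) (T1 + T2) Q g m.
Proof.
move=> H /andP[wf1 wf2] P l /code_at_cat[C1 C2].
have [t1 [g1 [m1 [tT1 E1 F1 N1 q1]]]] := H wf1 _ _ C1.
have [t2 [g2 [m2 [tT2 E2 F2 N2 q2]]]] := q1 wf2 _ _ C2.
exists (t1 + t2), g2, m2; split => //; first exact: leq_add.
- by rewrite addnC iterD E1 E2 size_cat addnA.
- by move=> x xt; rewrite inb_cat negb_or => /andP[x1 x2]; rewrite F2 ?F1.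
- by case/andP=> n1 n2; rewrite N2 ?N1.
Qed.

Lemma wp_if a b c1 c2 T1 T2 Q g m :
  (forall g', (forall y, y < tmp -> g' y = g y) ->
    if eval g m a < eval g m b then wp c1 T1 Q g' m else wp c2 T2 Q g' m) ->
  wp (IfLt a b c1 c2) ((ecost a + ecost b).+2 + (T1 + T2)) Q g m.
Proof.
move=> H /and4P[va vb wf1 wf2] P l; rewrite compile_if.
set l2 := (l + _).+1; set p2 := compile l2 c2.
set l1 := (l2 + _).+1; set p1 := compile l1 c1.
move=> /code_at_cat[Ch /code_at_cons[Cj /code_at_cat[C2 /code_at_cons[Cj2 C1]]]].
rewrite size_cat size_compile_pair /= size_cat /=.
rewrite size_compile_pair -?/l2 in Cj C1 C2 Cj2.
have [g1 [E1 V1 V2 F1]] := compile_pairP g m va vb Ch.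
have {H} := H g1 F1; case: ifP => ab H.
  have [t1 [g2 [m2 [tT1 E2 F2 N2 q2]]]] := H wf1 _ _ C1.
  exists (t1 + (ecost a + ecost b).+1), g2, m2; split => //.
  - lia.
  - rewrite iterD iterS E1 (stepE _ _ Cj) /= V1 V2 ab E2 -/l1 -/p1.
    congr State; rewrite /l1 /l2; lia.
  - move=> x xt; rewrite inb_cat negb_or => /andP[x1 x2]; rewrite F2 // F1 //.
  - by case/andP=> n1 n2; rewrite N2.
have [t1 [g2 [m2 [tT1 E2 F2 N2 q2]]]] := H wf2 _ _ C2.
exists (t1 + (ecost a + ecost b).+1).+1, g2, m2; split => //.
- lia.
- rewrite iterS iterD iterS E1 (stepE _ _ Cj) /= V1 V2 ab E2 (stepE _ _ Cj2) /=.
  congr State; rewrite /l1 /l2; lia.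
- move=> x xt; rewrite inb_cat negb_or => /andP[x1 x2]; rewrite F2 // F1 //.
- by case/andP=> n1 n2; rewrite N2.
Qed.

(** The invariant is indexed by the number of completed iterations, and [J] is their exact total.
    The quantification over [g'] absorbs the temporaries overwritten by the test. *)
Lemma wp_while a b c J T (I : nat -> (nat -> nat) -> (nat -> nat) -> Prop)
    (Q : _ -> _ -> Prop) g m :
  (forall j g m g', j < J -> I j g m -> (forall y, y < tmp -> g' y = g y) ->
     eval g m a < eval g m b /\ wp c T (I j.+1) g' m) ->
  (forall g m g', I J g m -> (forall y, y < tmp -> g' y = g y) ->
     eval g m b <= eval g m a /\ Q g' m) ->
  I 0 g m ->
  wp (WhileLt a b c) (J.+1 * ((ecost a + ecost b).+2 + T)) Q g m.
Proof.
move=> Hbody Hend I0 /and3P[va vb wfc] P l; rewrite compile_while.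
set L := (l + _).+2; set p := compile L c.
move=> /code_at_cat[Ch /code_at_cons[Cj /code_at_cons[Cj2 /code_at_cat[Cc Cb]]]].
rewrite size_cat size_compile_pair /= size_cat /=.
rewrite size_compile_pair -?/L in Cj Cc Cj2 Cb.
suff loop i j g1 m1 : i + j = J -> I j g1 m1 ->
  exists t g' m', [/\ t <= i.+1 * ((ecost a + ecost b).+2 + T),
    iter t (step w P) (State l g1 m1) = State (L + size p).+1 g' m',
    forall x, x < tmp -> ~~ inb x (writes c) -> g' x = g1 x,
    nostore c -> m' = m1 & Q g' m'].
  have [t [g' [m' [tT E F N q]]]] := loop J 0 g m (addn0 _) I0.
  exists t, g', m'; split => //; rewrite E; congr State; rewrite -/L -/p /L; lia.
elim: i j g1 m1 => [|i IH] j g1 m1 ij Ij.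
  have [g2 [E1 V1 V2 F1]] := compile_pairP g1 m1 va vb Ch.
  rewrite add0n in ij; subst j.
  have [ba q] := Hend _ _ _ Ij F1.
  exists (ecost a + ecost b).+2, g2, m1; split => //.
  - by rewrite mul1n leq_addr.
  - rewrite !iterS E1 (stepE _ _ Cj) /= V1 V2 ltnNge ba /= (stepE _ _ Cj2) /=.
    by congr State; rewrite -/L -/p /L; lia.
  - by move=> x xt _; apply: F1.
have [g2 [E1 V1 V2 F1]] := compile_pairP g1 m1 va vb Ch.
have [ab H] := Hbody _ _ _ g2 (ltac:(lia) : j < J) Ij F1.
have [t1 [g3 [m3 [tT1 E3 F3 N3 I3]]]] := H wfc _ _ Cc.
have [t2 [g4 [m4 [tT2 E4 F4 N4 q4]]]] := IH j.+1 _ _ (ltac:(lia) : i + j.+1 = J) I3.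
exists (t2 + (t1 + (ecost a + ecost b).+1).+1), g4, m4; split => //.
- by rewrite mulSn; lia.
- rewrite iterD iterS iterD iterS E1 (stepE _ _ Cj) /= V1 V2 ab.
  by rewrite E3 (stepE _ _ Cb) /= E4.
- by move=> x xt xc; rewrite F4 // F3 // F1.
- by move=> nc; rewrite N4 // N3.
Qed.

(** * Symbolic evaluation in natural numbers, without overflow *)

Definition env := seq (nat * nat).

Fixpoint look (E : env) (x : nat) : option nat :=
  if E is (y, v) :: E' then if Nat.eqb x y then Some v else look E' x else None.

Definition agr (E : env) (g : nat -> nat) : Prop :=
  forall x v, look E x = Some v -> x < tmp /\ g x = v.

Definition forget (W : seq nat) (E : env) : env := [seq p <- E | ~~ inb p.1 W].

(* [sev] evaluates without reduction modulo [2 ^ w]; this is what the machine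
   computes when [sok] holds. *)
Fixpoint sev (E : env) (m : nat -> nat) (e : expr) : nat :=
  match e with
  | Var x => odflt 0 (look E x)
  | Cst c => c
  | Bin o a b =>
      match o with
      | Add => sev E m a + sev E m b
      | Defs.Sub => sev E m a - sev E m b
      | Mul => sev E m a * sev E m b
      | Div => sev E m a %/ sev E m b
      | Mod => sev E m a %% sev E m b
      | _ => 0
      end
  | Fetch a => m (sev E m a)
  end.

Fixpoint sok (E : env) (m : nat -> nat) (e : expr) : Prop :=
  match e with
  | Var x => look E x <> None
  | Cst c => c < 2 ^ w
  | Bin o a b =>
      [/\ sok E m a, sok E m b &
      match o with
      | Add => sev E m a + sev E m b < 2 ^ w
      | Defs.Sub => sev E m b <= sev E m a < 2 ^ w
      | Mul => sev E m a * sev E m b < 2 ^ w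
      | Div | Mod => sev E m a < 2 ^ w
      | _ => False
      end]
  | Fetch a => sok E m a
  end.

Lemma agr_sev E g m e : agr E g -> sok E m e -> eval g m e = sev E m e.
Proof.
move=> Eg; elim: e => [x|c|o a IHa b IHb|a IHa] /=.
- by case D: (look E x) => [v|] // _; case: (Eg _ _ D).
- exact: modn_small.
- case=> /IHa-> /IHb->; rewrite /eval_binop; case: o => // H; try exact: modn_small.
  (* The machine subtracts by adding a complement, which exceeds the true difference by one
     modulus. *)
  + case/andP: H => ba aw; have -> : sev E m a + (2 ^ w - sev E m b) =
      sev E m a - sev E m b + 2 ^ w by lia.
    by rewrite modnDr modn_small // (leq_ltn_trans (leq_subr _ _)).
  + by rewrite modn_small // (leq_ltn_trans (leq_div _ _)).
  + by rewrite modn_small // (leq_ltn_trans (leq_mod _ _)).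
- by move=> /IHa->.
Qed.

Lemma look_forget W E x :
  look (forget W E) x = if inb x W then None else look E x.
Proof.
elim: E => [|[y v] E IH] /=; first by case: ifP.
case yW: (inb y W) => /=; rewrite IH Nat_eqbE; last by case: eqP => // ->; rewrite yW.
by case: eqP => [->|//]; rewrite yW.
Qed.

Lemma agr_same E g g' : agr E g -> (forall x, x < tmp -> g' x = g x) -> agr E g'.
Proof. by move=> Eg gg' x v /Eg[xt <-]; rewrite gg'. Qed.

Lemma agr_forget W E g g' :
  agr E g -> (forall x, x < tmp -> ~~ inb x W -> g' x = g x) -> agr (forget W E) g'.
Proof.
move=> Eg gg' x v; rewrite look_forget; case: ifP => // xW /Eg[xt <-].
by rewrite gg' ?xW.
Qed.

Lemma agr_cons x v E g : agr E g -> x < tmp -> g x = v -> agr ((x, v) :: E) g.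
Proof. by move=> Eg xt gx y u /=; rewrite Nat_eqbE; case: eqP => [-> [<-]|_ /Eg]. Qed.

Lemma agr_cat E1 E2 g : agr E1 g -> agr E2 g -> agr (E1 ++ E2) g.
Proof.
move=> E1g E2g x v; have -> : look (E1 ++ E2) x =
    if look E1 x is Some u then Some u else look E2 x.
  by elim: (E1) => //= -[y u] E ->; case: Nat.eqb.
by case D: (look E1 x) => [u|]; [case=> <-; apply: E1g|apply: E2g].
Qed.

Lemma agr_behead x v E g : look E x = None -> agr ((x, v) :: E) g -> agr E g.
Proof.
move=> Ex Eg y u yu; apply: Eg => /=; rewrite Nat_eqbE; case: eqP yu => // ->.
by rewrite Ex.
Qed.

Lemma agr_head x v E g : agr ((x, v) :: E) g -> x < tmp /\ g x = v.
Proof. by apply; rewrite /= Nat_eqbE eqxx. Qed.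

Section Rules.

Variable X : nat.
Implicit Types (E : env) (g m : nat -> nat) (Q : (nat -> nat) -> (nat -> nat) -> Prop).

Lemma wpe_skip Q g m : Q g m -> wp Skip (cost X Skip) Q g m.
Proof. exact: wp_skip. Qed.

Lemma wpe_then c1 c2 Q g m :
  wp c1 (cost X c1) (wp c2 (cost X c2) Q) g m ->
  wp (Then c1 c2) (cost X (Then c1 c2)) Q g m.
Proof. exact: wp_then. Qed.

Lemma wpe_assign E x e Q g m :
  agr E g -> sok E m e ->
  (forall g', agr ((x, sev E m e) :: forget [:: x] E) g' -> Q g' m) ->
  wp (Assign x e) (cost X (Assign x e)) Q g m.
Proof.
move=> Eg ok q; apply: wp_assign => g' xt gx gy; apply: q; apply: agr_cons => //.
  by apply: (agr_forget Eg) => y yt; rewrite /inb /= orbF Nat_eqbE => /gy->.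
by rewrite gx (agr_sev Eg ok).
Qed.

Lemma wpe_store E a e Q g m :
  agr E g -> sok E m a -> sok E m e ->
  (forall g', agr E g' -> Q g' (upd m (sev E m a) (sev E m e))) ->
  wp (Store a e) (cost X (Store a e)) Q g m.
Proof.
move=> Eg oka oke q; apply: wp_store => g' gg'.
by rewrite (agr_sev Eg oka) (agr_sev Eg oke); apply: q; apply: agr_same Eg gg'.
Qed.

Lemma wpe_if E a b c1 c2 Q g m :
  agr E g -> sok E m a -> sok E m b ->
  (forall g', agr E g' -> sev E m a < sev E m b -> wp c1 (cost X c1) Q g' m) ->
  (forall g', agr E g' -> sev E m b <= sev E m a -> wp c2 (cost X c2) Q g' m) ->
  wp (IfLt a b c1 c2) (cost X (IfLt a b c1 c2)) Q g m.
Proof.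
move=> Eg oka okb H1 H2; apply: wp_if => g' gg'.
have Eg' := agr_same Eg gg'.
rewrite (agr_sev Eg oka) (agr_sev Eg okb); case: ltnP => ab; [exact: H1|exact: H2].
Qed.

Lemma wpe_call E c (R : (nat -> nat) -> (nat -> nat) -> Prop) Q g m :
  wp c (cost X c) R g m -> agr E g ->
  (forall g' m', agr (forget (writes c) E) g' -> (nostore c -> m' = m) ->
     R g' m' -> Q g' m') ->
  wp c (cost X c) Q g m.
Proof.
move=> H Eg RQ; apply: wp_weaken H _ _ => // g' m' fr ns r.
by apply: RQ => //; apply: agr_forget Eg fr.
Qed.

(** The iteration count [J] and the body time [T] are independent here: the search loop runs
    exponentially often around a body of polynomial cost. *)
Lemma wpe_while_gen a b c J T (I : nat -> env -> (nat -> nat) -> Prop) E Q g m :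
  (forall j E m, j <= J -> I j E m ->
    [/\ sok E m a, sok E m b & (sev E m a < sev E m b) = (j < J)]) ->
  (forall j E g m, j < J -> I j E m -> agr E g ->
    wp c T (fun g' m' => exists2 E', I j.+1 E' m' & agr E' g') g m) ->
  (forall E g m, I J E m -> agr E g -> Q g m) ->
  I 0 E m -> agr E g ->
  wp (WhileLt a b c) (J.+1 * ((ecost a + ecost b).+2 + T)) Q g m.
Proof.
move=> cond body fin I0 Eg.
pose I' j g m := exists2 E, I j E m & agr E g.
apply: (wp_while (I := I')); last by exists E.
- move=> j g1 m1 g2 jJ [E1 I1 Eg1] gg; have [oka okb ab] := cond _ _ _ (ltnW jJ) I1.
  rewrite (agr_sev Eg1 oka) (agr_sev Eg1 okb) ab; split=> //.
  by apply: body jJ I1 _; apply: agr_same Eg1 gg.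
- move=> g1 m1 g2 [E1 I1 Eg1] gg; have [oka okb ab] := cond _ _ _ (leqnn _) I1.
  rewrite (agr_sev Eg1 oka) (agr_sev Eg1 okb) leqNgt ab ltnn; split=> //.
  by apply: fin I1 _; apply: agr_same Eg1 gg.
Qed.

Lemma wpe_while a b c J (I : nat -> env -> (nat -> nat) -> Prop) E Q g m :
  J <= X ->
  (forall j E m, j <= J -> I j E m ->
    [/\ sok E m a, sok E m b & (sev E m a < sev E m b) = (j < J)]) ->
  (forall j E g m, j < J -> I j E m -> agr E g ->
    wp c (cost X c) (fun g' m' => exists2 E', I j.+1 E' m' & agr E' g') g m) ->
  (forall E g m, I J E m -> agr E g -> Q g m) ->
  I 0 E m -> agr E g ->
  wp (WhileLt a b c) (cost X (WhileLt a b c)) Q g m.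
Proof.
move=> JX cond body fin I0 Eg.
apply: wp_weaken (wpe_while_gen cond body fin I0 Eg) _ _ => //.
by rewrite /= leq_mul2r ltnS JX orbT.
Qed.

Definition For (x b : nat) (c : cmd) : cmd :=
  Then (Assign x (Cst 0))
    (WhileLt (Var x) (Var b) (Then c (Assign x (Bin Add (Var x) (Cst 1))))).

(** The environment of the invariant omits the counter; the rule adds its binding and asks the body
    to preserve it. *)
Lemma wpe_for x b c B (I : nat -> env -> (nat -> nat) -> Prop) E Q g m :
  B <= X -> B < 2 ^ w -> x != b ->
  (forall v E m, I v E m -> look E b = Some B /\ look E x = None) ->
  (forall v E g m, v < B -> I v E m -> agr ((x, v) :: E) g ->
    wp c (cost X c)
      (fun g' m' => exists2 E', I v.+1 E' m' & agr ((x, v) :: E') g') g m) ->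
  (forall E g m, I B E m -> agr E g -> Q g m) ->
  I 0 E m -> agr E g ->
  wp (For x b c) (cost X (For x b c)) Q g m.
Proof.
move=> BX Bw xb wfI body fin I0 Eg; apply: wpe_then.
apply: (wpe_assign Eg) => [|g1 Eg1]; first by rewrite /= expn_gt0.
pose I' v E1 m1 := exists2 E2, E1 = (x, v) :: E2 & I v E2 m1.
have eqb_bx : Nat.eqb b x = false by rewrite Nat_eqbE eq_sym (negPf xb).
apply: (wpe_while BX (I := I') _ _ _ (E := (x, 0) :: E)).
- move=> j _ m1 jB [E2 -> I2]; have [lb lx] := wfI _ _ _ I2.
  by split; rewrite /= ?eqb_bx ?(Nat_eqbE x x) ?eqxx ?lb.
- move=> j _ g2 m1 jB [E2 -> I2] Eg2; apply: wpe_then.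
  apply: wp_weaken (body _ _ _ _ jB I2 Eg2) _ _ => // g3 m3 _ _ [E3 I3 Eg3].
  have [lb lx] := wfI _ _ _ I3.
  apply: (wpe_assign Eg3) => [|g4 Eg4].
    rewrite /= (Nat_eqbE x x) eqxx; split => //=; last by rewrite addn1; lia.
    by apply: leq_trans (_ : B < _) ; lia.
  exists ((x, j.+1) :: E3); first by exists E3.
  move: Eg4; rewrite /= (Nat_eqbE x x) eqxx /= addn1 => Eg4.
  have [xt gx] := agr_head Eg4; apply: agr_cons => // y u yu.
  apply: Eg4; rewrite /= look_forget /inb /= orbF !Nat_eqbE /=.
  by case: (eqVneq y x) yu => // ->; rewrite lx.
- move=> _ g2 m1 [E2 -> I2] Eg2; have [lb lx] := wfI _ _ _ I2.
  by apply: fin I2 _; apply: agr_behead Eg2.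
- by exists E.
have [_ lx] := wfI _ _ _ I0; have [xt gx] := agr_head Eg1.
apply: agr_cons => // y u yu; apply: Eg1.
rewrite /= look_forget /inb /= orbF !Nat_eqbE.
by case: (eqVneq y x) yu => // ->; rewrite lx.
Qed.

Definition fresh (W : seq nat) E : bool := all (fun p => ~~ inb p.1 W) E.

Lemma look_fresh W E x : fresh W E -> inb x W -> look E x = None.
Proof.
move=> fE xW; elim: E fE => //= -[y v] E IH /andP[/= yW /IH ->].
by rewrite Nat_eqbE; case: eqP xW => // ->; rewrite (negPf yW).
Qed.

(** A loop that only ever raises a flag computes [has]. The flag starts from an arbitrary [h], so
    such loops nest while sharing one flag. Freshness makes the bindings of [E] survive the body. *)
Lemma wpe_any x b c B (p : pred nat) f h E g m :
  B <= X -> B < 2 ^ w -> nostore c ->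
  [&& x != b, f != b, f != x, ~~ inb x (writes c), fresh (x :: writes c) E &
      inb f (writes c)] ->
  look E b = Some B ->
  (forall v h g, v < B -> agr [:: (x, v), (f, h) & E] g ->
    wp c (cost X c) (fun g' _ => g' f = if p v then 1 else h) g m) ->
  agr ((f, h) :: E) g ->
  wp (For x b c) (cost X (For x b c))
    (fun g' _ => g' f = if has p (iota 0 B) then 1 else h) g m.
Proof.
move=> BX Bw ns /and5P[xb fb fx xc /andP[fE fc]] lb body Eg.
pose I v E1 m1 := E1 = (f, if has p (iota 0 v) then 1 else h) :: E /\ m1 = m.
have lx : look E x = None by apply: look_fresh fE _; rewrite /inb /= Nat_eqbE eqxx.
apply: (wpe_for BX Bw xb (I := I) _ _ _ (E := (f, h) :: E)) => //.
- move=> v _ _ [-> _] /=; rewrite lb lx (Nat_eqbE b f) (Nat_eqbE x f).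
  by rewrite [b == f]eq_sym (negPf fb) [x == f]eq_sym (negPf fx).
- move=> v _ g1 m1 vB [-> ->] Eg1.
  apply: (wpe_call (body _ _ _ vB Eg1) Eg1) => g2 m2 Eg2 /(_ ns)-> gf.
  exists ((f, if has p (iota 0 v.+1) then 1 else h) :: E) => //.
  have [ft _] : f < tmp /\ g1 f = if has p (iota 0 v) then 1 else h.
    by apply: Eg1; rewrite /= (Nat_eqbE f x) (negPf fx) Nat_eqbE eqxx.
  have [xt gx] : x < tmp /\ g2 x = v.
    by apply: Eg2; rewrite look_forget (negPf xc) /= Nat_eqbE eqxx.
  apply: agr_cons => //; apply: agr_cons => //; last first.
    rewrite gf -[v.+1]addn1 iotaD has_cat add0n /= orbF.
    by case: (p v); case: has.
  have fE' : fresh (writes c) E.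
    by apply: sub_all fE => q; rewrite /inb /= negb_or => /andP[].
  move=> y u yu; apply: Eg2; rewrite look_forget.
  case: ifP => [/(look_fresh fE')|yc]; first by rewrite yu.
  rewrite /= !Nat_eqbE; case: eqP yu => [->|_]; first by rewrite lx.
  by case: eqP => [->|//]; rewrite (look_fresh fE' fc).
- by move=> _ g1 _ [-> _] /agr_head[].
Qed.

End Rules.

End Wp.

Arguments wpe_assign {w X E x e Q g m}.
Arguments wpe_store {w X E a e Q g m}.
Arguments wpe_skip {w X Q g m}.
Arguments cost : simpl never.

(** * Enumeration of sequences and covering of windows *)

(** Bijective base-[q] numeration, least significant digit first. *)
Definition rank (q : nat) (l : seq nat) : nat := foldr (fun a r => a + q * r) 0 l.

Definition digits (q : nat) (l : seq nat) : bool := all (fun a => 1 <= a <= q) l.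

Lemma digits_nth q l i : digits q l -> i < size l -> 1 <= nth 0 l i <= q.
Proof. by move=> dl il; apply: (allP dl); apply: mem_nth. Qed.

(** If the tails had different ranks, the multiples of [q] would differ by at least [q], while two
    first digits differ by less than [q]. *)
Lemma rank_inj q u v : digits q u -> digits q v -> rank q u = rank q v -> u = v.
Proof.
elim: u v => [|a u IH] [|b v] //=; try by move=> *; lia.
move=> /andP[ha hu] /andP[hb hv] E.
have eab : a = b.
  case: (ltngtP (rank q u) (rank q v)) => [lt|lt|eq]; last by move: E; rewrite eq; lia.
    have := leq_mul (leqnn q) lt; rewrite mulnS; lia.
  have := leq_mul (leqnn q) lt; rewrite mulnS; lia.
congr (_ :: _); [exact: eab|apply: IH => //].
have q0 : 0 < q by lia.
by apply/eqP; rewrite -(eqn_pmul2l q0); apply/eqP; move: E; rewrite eab; lia.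
Qed.

Lemma rank_lt q l : digits q l -> rank q l < q.+1 ^ size l.
Proof.
elim: l => //= a l IH /andP[ha /IH h].
by rewrite expnS; have := leq_mul (leqnn q.+1) h; rewrite mulSn mulnS; lia.
Qed.

Lemma rank_lt_double q l : 1 < q -> digits q l -> rank q l < 2 * q ^ size l.
Proof.
(* The slack 2 closes the induction: [a + q * r + 2 <= q * (r + 2)], because [a <= q] and
   [2 <= q]. *)
move=> q1; suff H : digits q l -> (rank q l).+2 <= 2 * q ^ size l.
  by move=> /H; apply: ltnW.
elim: l => //= a l IH /andP[ha /IH h].
by rewrite expnS mulnCA; have := leq_mul (leqnn q) h; rewrite !mulnS; lia.
Qed.

Fixpoint incr (q : nat) (l : seq nat) : seq nat :=
  if l is a :: l' then if a < q then a.+1 :: l' else 1 :: incr q l' else [:: 1].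

Lemma rank_incr q l : digits q l -> rank q (incr q l) = (rank q l).+1.
Proof.
elim: l => [|a l IH] /=; first by rewrite muln0.
move=> /andP[ha hl]; case: ifP => aq //=; rewrite (IH hl) mulnS; lia.
Qed.

Lemma digits_incr q l : 0 < q -> digits q l -> digits q (incr q l).
Proof.
move=> q0; elim: l => [|a l IH] /=; first by rewrite q0.
move=> /andP[ha hl]; case: ifP => aq /=; first by rewrite /digits /= in hl *; rewrite hl; lia.
by rewrite q0 IH.
Qed.

Lemma size_incr q l : size l <= size (incr q l).
Proof. by elim: l => //= a l IH; case: ifP. Qed.

Lemma rank_iter_incr q r : 0 < q ->
  digits q (iter r (incr q) [::]) /\ rank q (iter r (incr q) [::]) = r.
Proof.
move=> q0; elim: r => //= r [h e].
by rewrite digits_incr // rank_incr // e.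
Qed.

Lemma iter_incr_rank q l : 0 < q -> digits q l -> iter (rank q l) (incr q) [::] = l.
Proof.
move=> q0 hl; have [h e] := rank_iter_incr (rank q l) q0.
exact: (@rank_inj q).
Qed.

(** An increment never shortens a sequence; hence the first success of the enumeration is a shortest
    one. *)
Lemma size_iter_incr q r r' :
  r <= r' -> size (iter r (incr q) [::]) <= size (iter r' (incr q) [::]).
Proof.
elim: r' => [|r' IH]; first by rewrite leqn0 => /eqP ->.
rewrite leq_eqVlt => /predU1P[-> //|/IH h] /=.
exact: leq_trans h (size_incr _ _).
Qed.

(** The increment as an update in place: the leading digits [q] become 1 and the next cell is
    raised. The default 0 makes an appended digit 1 an instance of the same rule. *)
Lemma nth_incr q l i : digits q l -> 0 < q ->
  let J := find (fun a => a < q) l in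
  nth 0 (incr q l) i =
    if i < J then 1 else if i == J then (nth 0 l J).+1 else nth 0 l i.
Proof.
move=> + q0; elim: l i => [|a l IH] i /=; first by case: i => [|[]].
move=> /andP[ha dl]; case: ifP => aq /=; first by case: i.
by case: i => //= i; rewrite IH // ltnS eqSS.
Qed.

Lemma size_incr_find q l :
  size (incr q l) = maxn (size l) (find (fun a => a < q) l).+1.
Proof.
elim: l => //= a l IH; case: ifP => aq /=; first by rewrite maxnSS maxn0.
by rewrite IH maxnSS.
Qed.

(** * Windows, covers and interchangeable positions *)

Section Covers.

Variables (S : seq nat) (k : nat).
Notation n := (size S).
Notation s := (nth 0 S).

(* Positions are 0-based here and [l] is the length of the window minus one. *)
Definition covered (G : seq nat) (i l : nat) : Prop :=
  exists y i', [/\ y \in G, i' <= y <= i' + l, i' + l < n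
                 & forall j, j <= l -> s (i' + j) = s (i + j)].

Definition covers (G : seq nat) : Prop :=
  forall i l, l < k -> i + l < n -> covered G i l.

(** One-sided: whatever [p] covers, [p'] covers at the same offset, so [p'] may replace [p]. *)
Definition sim (p p' : nat) : Prop :=
  forall i l, l < k -> i <= p <= i + l -> i + l < n ->
    [/\ p - i <= p', p' - (p - i) + l < n
      & forall j, j <= l -> s (p' - (p - i) + j) = s (i + j)].

Definition mismatch (i i' l : nat) : bool :=
  has (fun j => s (i + j) != s (i' + j)) (iota 0 l).

(** Here [e] is the offset of [y] in the candidate occurrence. The right end is compared additively,
    to keep truncated subtraction out of the test. *)
Definition match_at (i l y e : nat) : bool :=
  [&& e <= l, e <= y, y + l < n + e & ~~ mismatch i (y - e) l.+1].

Definition matched (G : seq nat) (i l : nat) : bool :=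
  has (fun iy => has (match_at i l (nth 0 G iy)) (iota 0 k)) (iota 0 (size G)).

Definition bad_at (G : seq nat) (x d l : nat) : bool :=
  [&& d <= l, d <= x, x + l < n + d & ~~ matched G (x - d) l].

(* Some window through an element of [A] equals no window through an element of [G]. *)
Definition bad (A G : seq nat) : bool :=
  has (fun ix => has (fun d => has (bad_at G (nth 0 A ix) d) (iota 0 k))
         (iota 0 k)) (iota 0 (size A)).

Lemma matchedP G i l : l < k -> reflect (covered G i l) (matched G i l).
Proof.
move=> lk; apply: (iffP hasP) => [[iy]|[y [i' [yG iy il e]]]].
  rewrite mem_iota add0n => /= iyG /hasP[e]; rewrite mem_iota add0n => /= ek.
  case/and4P=> el ey yl /hasPn mm; exists (nth 0 G iy), (nth 0 G iy - e).
  split; [exact: mem_nth|lia|lia|move=> j jl].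
  by apply/esym/eqP; rewrite -[_ == _]negbK mm // mem_iota; lia.
exists (index y G); first by rewrite mem_iota add0n index_mem.
apply/hasP; exists (y - i'); first by rewrite mem_iota; lia.
rewrite nth_index //; apply/and4P; split; try lia.
apply/hasPn => j; rewrite mem_iota => jl; rewrite negbK subKn; last by lia.
by rewrite e //; lia.
Qed.

(** Any window reappears at the representative of its own first position, with offset 0; the windows
    through [A] therefore exhaust all the contents to be covered. *)
Lemma badP A G : (forall p, p < n -> exists2 p', p' \in A & sim p p') ->
  ~~ bad A G <-> covers G.
Proof.
move=> rep; split=> [nb i l lk iln|cov].
  have [|p' pA sm] := rep i; first by lia.
  have [h1 h2 h3] := sm i l lk (ltac:(lia)) iln.
  have : matched G p' l.
    apply: contraNT nb => nm; apply/hasP; exists (index p' A).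
      by rewrite mem_iota add0n index_mem.
    apply/hasP; exists 0; first by rewrite mem_iota; lia.
    apply/hasP; exists l; first by rewrite mem_iota; lia.
    by rewrite nth_index // /bad_at subn0 nm; lia.
  case/(matchedP _ _ lk) => y [i' [yG iy il e]]; exists y, i'; split=> // j jl.
  by rewrite e // -h3 //; congr s; lia.
apply/hasPn => ix _; apply/hasPn => d _; apply/hasPn => l.
rewrite mem_iota => lk; apply/negP => /and4P[dl dx xl /negP[]].
by apply/matchedP; [lia|apply: cov; lia].
Qed.

(** An occurrence through [y] moves, with the offset of [y], to one through the representative of
    [y]. Replacing element by element keeps the length. *)
Lemma covers_reps (A G : seq nat) : (forall p, p < n -> exists2 p', p' \in A & sim p p') ->
  all (fun p => p < n) G -> covers G ->
  exists G' : seq nat, [/\ size G' = size G, {subset G' <= A} & covers G'].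
Proof.
move=> rep Gn cov.
suff [G' [sz sub H]] : exists G' : seq nat, [/\ size G' = size G, {subset G' <= A} &
    forall y, y \in G -> exists2 y', y' \in G' & sim y y'].
  exists G'; split=> // i l lk il; have [y [i' [yG h1 h2 h3]]] := cov i l lk il.
  have [y' yG' sm] := H _ yG; have [e1 e2 e3] := sm _ _ lk h1 h2.
  exists y', (y' - (y - i')); split=> //; first by lia.
  by move=> j jl; rewrite e3 // h3.
elim: G Gn {cov} => [|y G IH] /=; first by exists [::].
move=> /andP[/rep[y' yA sm] /IH[G' [sz sub H]]]; exists (y' :: G'); split.
- by rewrite /= sz.
- by move=> z; rewrite inE => /predU1P[->|/sub].
- move=> z; rewrite inE => /predU1P[->|/H[z' zG' smz]]; first by exists y'; rewrite ?mem_head.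
  by exists z' => //; rewrite inE zG' orbT.
Qed.

Lemma covers_iota : covers (iota 0 n).
Proof.
move=> i l lk il; exists i, i; split=> //; rewrite ?mem_iota; lia.
Qed.

Definition window i l := take l.+1 (drop i S).

Lemma size_window i l : i + l < n -> size (window i l) = l.+1.
Proof. by move=> il; rewrite size_take size_drop; case: ltnP => //; lia. Qed.

Lemma nth_window i l j : j <= l -> nth 0 (window i l) j = s (i + j).
Proof. by move=> jl; rewrite nth_take // nth_drop. Qed.

(** Induction on a strict bound for the ranks of the windows already covered: the rank determines
    the window, so one more position settles one more rank. *)
Lemma covers_exp_size sigma : 1 < sigma -> digits sigma S ->
  exists G, [/\ size G <= 2 * sigma ^ k, all (fun p => p < n) G & covers G].
Proof.
move=> s1 dS.
have dw i l : digits sigma (window i l).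
  by apply/allP => a /mem_take/mem_drop; apply: (allP dS).
suff [G [sz Gn H]] : exists G, [/\ size G <= 2 * sigma ^ k, all (fun p => p < n) G &
    forall i l, i + l < n -> rank sigma (window i l) < 2 * sigma ^ k -> covered G i l].
  exists G; split=> // i l lk il; apply: H => //.
  apply: leq_trans (rank_lt_double s1 (dw i l)) _; rewrite size_window //.
  by rewrite leq_mul2l leq_exp2l.
elim: (2 * sigma ^ k) => [|r [G [sz Gn H]]]; first by exists [::].
case: (boolP (has (fun i => has (fun l => (i + l < n) && (rank sigma (window i l) == r))
   (iota 0 n)) (iota 0 n))) => [/hasP[i0 hi /hasP[l0 hl /andP[il0 /eqP er]]]|/hasPn no].
  exists (i0 :: G); split=> //=; first by rewrite Gn andbT; lia.
  move=> i l il; rewrite ltnS leq_eqVlt => /predU1P[e|/(H _ _ il)]; last first.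
    move=> [y [i' [yG h1 h2 h3]]]; exists y, i'; split=> //.
    by rewrite inE yG orbT.
  have ew : window i0 l0 = window i l.
    by apply: (@rank_inj sigma); rewrite ?er.
  have el : l0 = l by have := congr1 size ew; rewrite !size_window // => -[].
  subst l0; exists i0, i0; split=> //; first by rewrite mem_head.
    by lia.
  by move=> j jl; rewrite -!(nth_window _ jl) ew.
exists G; split=> //; first exact: leqW.
move=> i l il; rewrite ltnS leq_eqVlt => /predU1P[e|/(H _ _ il) //].
have /no/hasPn/(_ l) : i \in iota 0 n by rewrite mem_iota; lia.
by rewrite il e eqxx mem_iota => /(_ ltac:(lia)).
Qed.

(** * Rolling codes of the contexts *)

Section RollingCode.

Variables B D E F : nat.

Fixpoint rolling (t : nat) : nat :=
  if t is t'.+1 then (rolling t' * B + (s t' * E + F)) %% D else 0.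

End RollingCode.

(** The modulus keeps the last [M] letters read, as digits in base [B]; places before the string
    count as 0. *)
Lemma rolling_digit B M t j : 0 < B -> (forall i, s i < B) -> j < M ->
  (rolling B (B ^ M) 1 0 t %/ B ^ j) %% B = if j < t then s (t - j.+1) else 0.
Proof.
move=> B0 sB; elim: t j => [|t IH] j jM /=; first by rewrite div0n mod0n.
rewrite muln1 addn0; set x := _ + _.
(* Reduction modulo a multiple of [B ^ j.+1] does not affect digit [j]. *)
have -> : (x %% B ^ M %/ B ^ j) %% B = (x %/ B ^ j) %% B.
  rewrite [in RHS](divn_eq x (B ^ M)).
  have -> : B ^ M = B ^ (M - j.+1) * B * B ^ j by rewrite -!expnSr -expnD; congr (_ ^ _); lia.
  rewrite !mulnA divnMDl ?expn_gt0 ?B0 //.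
  by rewrite modnMDl.
case: j jM => [|j] jM.
  by rewrite expn0 divn1 /x modnMDl modn_small // subn1.
rewrite expnS divnMA /x divnMDl // (divn_small (sB t)) addn0 IH; last by lia.
by rewrite ltnS subSS.
Qed.

(** A window of length at most [k] through [p] lies within the [2 * k] letters in the code of [p].
    Letters being positive, its digits are nonzero, and nonzero digits in the code of [p'] come from
    places inside the string: the moved window overhangs neither end. *)
Lemma rolling_sim B p p' : 0 < k -> 0 < B -> (forall i, s i < B) ->
  (forall i, i < n -> 0 < s i) ->
  rolling B (B ^ (2 * k)) 1 0 (p + k) = rolling B (B ^ (2 * k)) 1 0 (p' + k) ->
  sim p p'.
Proof.
move=> k0 B0 sB spos e i l lk ipl il.
have D j : j <= l -> [/\ p + k - (i + j).+1 < p' + k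
    & s (i + j) = s (p' + k - (p + k - (i + j).+1).+1)].
  move=> jl; have := congr1 (fun c => (c %/ B ^ (p + k - (i + j).+1)) %% B) e.
  rewrite /= !rolling_digit //; try lia.
  rewrite ifT; last by lia.
  have -> : p + k - (p + k - (i + j).+1).+1 = i + j by lia.
  case: ifP => // _ e0; have := spos (i + j); rewrite e0; lia.
have [h0 _] := D 0 isT.
have D' j : j <= l -> s (p' - (p - i) + j) = s (i + j).
  by move=> jl; have [h1 ->] := D j jl; congr s; lia.
split=> //; first by lia.
rewrite ltnNge; apply/negP => h; have := D' l (leqnn l).
by rewrite nth_default //; have := spos _ il; lia.
Qed.

(** With base 1, letter factor 0 and increment 1 the code is a counter. All positions then get
    different codes, so the same scan also serves to keep every position. *)
Lemma rolling_count D t : t < D -> rolling 1 D 0 1 t = t.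
Proof.
elim: t => //= t IH tD; rewrite IH; last by lia.
by rewrite muln1 muln0 add0n addn1 modn_small.
Qed.

Lemma sim_refl p : sim p p.
Proof.
move=> i l lk ipl il; have -> : p - (p - i) = i by lia.
by split=> //; lia.
Qed.

(** * Passage between attractors and 0-based covers *)

Lemma nth_substr i j t : 0 < i -> i + t <= j -> nth 0 (substr S i j) t = s (i.-1 + t).
Proof. by move=> i0 itj; rewrite nth_drop nth_take //; lia. Qed.

Lemma size_substr i j : j <= n -> size (substr S i j) = j - i.-1.
Proof. by move=> jn; rewrite size_drop size_takel. Qed.

Lemma covers_attractor L :
  all (fun p => p < n) L -> covers L ->
  is_attractor k S [fset p in map succn L]%fset.
Proof.
move=> Ln cov; split=> [p|i j i1 ij jn jik].
  by rewrite inE /= => /mapP[q /(allP Ln) qn ->].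
have [|y [i' [yL h1 h2 h3]]] := cov i.-1 (j - i) (ltac:(lia)); first by lia.
exists i'.+1, (i' + (j - i)).+1; split; try lia; last first.
  by exists y.+1; [rewrite inE /=; apply: map_f|lia].
apply: (@eq_from_nth _ 0); first by rewrite !size_substr //; lia.
move=> t; rewrite size_substr; last by lia.
by move=> ht; rewrite !nth_substr //; try lia; apply: h3; lia.
Qed.

Lemma attractor_covers (G : {fset nat}) : is_attractor k S G ->
  all (fun p => p < n) (map predn G) /\ covers (map predn G).
Proof.
move=> [Gn H]; split.
  by apply/allP => _ /mapP[p /Gn hp ->]; lia.
move=> i l lk il.
have [//||//||i' [j' [h1 h2 e [p pG hp]]]] := H i.+1 (i + l).+1; try lia.
have sz : j' = i' + l.
  by have := congr1 size e; rewrite !size_substr //; lia.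
exists p.-1, i'.-1; split; try lia; first exact: map_f.
move=> t tl; have := congr1 (nth 0 ^~ t) e.
by rewrite !nth_substr //; try lia.
Qed.

End Covers.

(** Windows fit in the string. Truncating [k] makes the loops over [k] linear in [n]. *)
Lemma covers_minn S k G : covers S (minn k (size S)) G <-> covers S k G.
Proof. by split=> H i l lk il; apply: H => //; rewrite leq_min in lk *; lia. Qed.

(** * Searching for a shortest cover *)

Local Notation "c1 ;; c2" := (Then c1 c2) (at level 60, right associativity).
Local Notation "x <~ e" := (Assign x e) (at level 55).
Local Notation "a [+] b" := (Bin Add a b) (at level 50, left associativity).
Local Notation "a [-] b" := (Bin Defs.Sub a b) (at level 50, left associativity).
Local Notation "a [*] b" := (Bin Mul a b) (at level 40, left associativity).

Local Notation rn := 0 (only parsing).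
Local Notation rs := 1 (only parsing).
Local Notation rk := 2 (only parsing).
Local Notation rN := 3 (only parsing).
Local Notation rB := 5 (only parsing).
Local Notation rD := 6 (only parsing).
Local Notation rE := 7 (only parsing).
Local Notation rF := 8 (only parsing).
Local Notation rQ := 9 (only parsing).
Local Notation rT := 10 (only parsing).
Local Notation rA := 11 (only parsing).
Local Notation rtb := 12 (only parsing).
Local Notation rt := 13 (only parsing).
Local Notation rc := 14 (only parsing).
Local Notation rq := 15 (only parsing).
Local Notation rm := 16 (only parsing).
Local Notation rf := 17 (only parsing).
Local Notation rix := 18 (only parsing).
Local Notation rx := 19 (only parsing).
Local Notation rd := 20 (only parsing).
Local Notation rl := 21 (only parsing).
Local Notation rlen := 22 (only parsing).
Local Notation ri := 23 (only parsing).
Local Notation rh := 24 (only parsing).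
Local Notation riy := 25 (only parsing).
Local Notation ry := 26 (only parsing).
Local Notation re := 27 (only parsing).
Local Notation ri' := 28 (only parsing).
Local Notation rb := 29 (only parsing).
Local Notation rj := 30 (only parsing).

Definition compare_cmd : cmd :=
  rb <~ Cst 0 ;;
  For rj rlen
    (IfLt (Fetch (Var ri [+] Var rj)) (Fetch (Var ri' [+] Var rj)) (rb <~ Cst 1)
    (IfLt (Fetch (Var ri' [+] Var rj)) (Fetch (Var ri [+] Var rj)) (rb <~ Cst 1)
    Skip)).

Definition try_cmd : cmd :=
  IfLt (Var rl) (Var re) Skip
  (IfLt (Var ry) (Var re) Skip
  (IfLt (Var ry [+] Var rl) (Var rn [+] Var re)
    (ri' <~ Var ry [-] Var re ;; compare_cmd ;; IfLt (Var rb) (Cst 1) (rh <~ Cst 1) Skip)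
    Skip)).

Definition find_cmd : cmd :=
  rh <~ Cst 0 ;;
  For riy rm
    (ry <~ Fetch (Var rQ [+] Fetch (Var rA [+] Var riy)) ;; For re rk try_cmd).

Definition window_cmd : cmd :=
  IfLt (Var rl) (Var rd) Skip
  (IfLt (Var rx) (Var rd) Skip
  (IfLt (Var rx [+] Var rl) (Var rn [+] Var rd)
    (rlen <~ Var rl [+] Cst 1 ;; ri <~ Var rx [-] Var rd ;; find_cmd ;;
     IfLt (Var rh) (Cst 1) (rf <~ Cst 1) Skip)
    Skip)).

Definition check_cmd : cmd :=
  rf <~ Cst 0 ;;
  For rix rq
    (rx <~ Fetch (Var rQ [+] (Var rix [+] Cst 1)) ;; For rd rk (For rl rk window_cmd)).

(* The cells after the last digit contain 0, so that incrementing the first digit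
   that is not [q] also covers the case where the sequence gets longer. *)
Definition next_cmd : cmd :=
  ri <~ Cst 0 ;;
  WhileLt (Var rq) (Fetch (Var rA [+] Var ri) [+] Cst 1)
    (Store (Var rA [+] Var ri) (Cst 1) ;; ri <~ Var ri [+] Cst 1) ;;
  Store (Var rA [+] Var ri) (Fetch (Var rA [+] Var ri) [+] Cst 1) ;;
  IfLt (Var rm) (Var ri [+] Cst 1) (rm <~ Var ri [+] Cst 1) Skip.

Definition search_cmd : cmd :=
  check_cmd ;; WhileLt (Cst 0) (Var rf) (next_cmd ;; check_cmd).

Definition output_cmd : cmd :=
  For ri rm
    (Store (Var rA [+] Var ri) (Fetch (Var rQ [+] Fetch (Var rA [+] Var ri)) [+] Cst 1)) ;;
  rn <~ Var rm ;; rs <~ Var rA.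

Ltac ok := rewrite /=; repeat split; rewrite //=; try lia.

Lemma agr_sub E E' g :
  agr E g -> all (fun p => look E p.1 == Some p.2) E' -> agr E' g.
Proof.
move=> Eg sub x v xv; apply: Eg; elim: E' sub xv => //= -[y u] E' IH /=.
by move=> /andP[/eqP hy /IH{}IH]; rewrite Nat_eqbE; case: eqP => [-> [<-]|].
Qed.

(** Digits start at 1, indices in [A] at 0. *)
Definition positions (A l : seq nat) : seq nat := map (fun a => nth 0 A a.-1) l.

Lemma nth_lt_all b (A : seq nat) i :
  all (fun p => p < b) A -> i < size A -> nth 0 A i < b.
Proof. by move=> An iq; apply: (allP An); apply: mem_nth. Qed.

Lemma nth_positions_lt b (A l : seq nat) i : all (fun p => p < b) A ->
  digits (size A) l -> i < size l -> nth 0 (positions A l) i < b.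
Proof.
move=> An dl il; have /andP[h1 h2] := digits_nth dl il.
by rewrite (nth_map 0) //; apply: nth_lt_all An _; lia.
Qed.

(** * Specifications of the search commands *)

Section Search.

Variables (w X : nat) (S A : seq nat) (k q0 a0 : nat).
Notation n := (size S).
Notation q := (size A).

Hypothesis kn : k <= n.
Hypothesis kX : k <= X.
Hypothesis qX : q <= X.
Hypothesis qn : q <= n.
Hypothesis hq0 : q0 + n.+1 < 2 ^ w.
Hypothesis ha0 : a0 + n.+1 < 2 ^ w.
Hypothesis hn : 2 * n.+1 < 2 ^ w.
Hypothesis hna : n <= a0.
Hypothesis hqa : q0 + q < a0.
Hypothesis An : all (fun p => p < n) A.

(** The representatives start in cell [q0 + 1], so that a digit is directly an offset from [q0]. The
    last clause has no bound on [i]: the cells after the digits contain 0. *)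
Definition search_mem (l : seq nat) (m : nat -> nat) : Prop :=
  [/\ forall a, a < n -> m a = nth 0 S a,
      forall i, i < q -> m (q0 + i.+1) = nth 0 A i
    & forall i, m (a0 + i) = nth 0 l i].

Lemma compare_spec m i i' l g :
  (forall a, a < n -> m a = nth 0 S a) -> i + l <= n -> i' + l <= n -> l <= k ->
  agr [:: (ri, i); (ri', i'); (rlen, l)] g ->
  wp w compare_cmd (cost X compare_cmd)
    (fun g' _ => g' rb = mismatch S i i' l) g m.
Proof.
move=> mS il il' lk Eg; apply: wpe_then.
apply: (wpe_assign Eg) => [|{Eg}g Eg]; first by ok.
rewrite /= in Eg.
have -> : mismatch S i i' l = (if mismatch S i i' l then 1 else 0) :> nat by case: mismatch.
apply: (wpe_any (B := l) _ _ _ _ _ _ Eg) => //; try lia.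
move=> v h {Eg}g vl Eg.
apply: (wpe_if Eg) => [||{Eg}g Eg|{Eg}g Eg]; try by ok.
- rewrite /= !mS; try lia.
  move=> lt; apply: (wpe_assign Eg) => [|g1 Eg1]; first by ok.
  have [_ ->] := agr_head Eg1; rewrite /= ifT //; lia.
- rewrite /= !mS; try lia.
  move=> le; apply: (wpe_if Eg) => [||{Eg}g Eg|{Eg}g Eg]; try by ok.
  + rewrite /= !mS; try lia.
    move=> lt; apply: (wpe_assign Eg) => [|g1 Eg1]; first by ok.
    have [_ ->] := agr_head Eg1; rewrite /= ifT //; lia.
  + rewrite /= !mS; try lia.
    move=> le'; apply: wpe_skip; rewrite ifF; last by lia.
    by have [|_ ->] := Eg rb h.
Qed.

Lemma try_spec m i l y e h g :
  (forall a, a < n -> m a = nth 0 S a) -> i + l < n -> y < n -> e < k -> l < k ->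
  agr [:: (re, e); (rh, h); (ry, y); (ri, i); (rlen, l.+1); (rl, l); (rn, n)] g ->
  wp w try_cmd (cost X try_cmd)
    (fun g' _ => g' rh = if match_at S i l y e then 1 else h) g m.
Proof.
move=> mS il yn ek lk Eg.
apply: (wpe_if Eg) => [||{Eg}g Eg /= h1|{Eg}g Eg /= h1]; try by ok.
  apply: wpe_skip; rewrite ifF; last by rewrite /match_at leqNgt h1.
  by have [|_ ->] := Eg rh h.
apply: (wpe_if Eg) => [||{Eg}g Eg /= h2|{Eg}g Eg /= h2]; try by ok.
  apply: wpe_skip; rewrite ifF; last by rewrite /match_at [e <= y]leqNgt h2 andbF.
  by have [|_ ->] := Eg rh h.
apply: (wpe_if Eg) => [||{Eg}g Eg /= h3|{Eg}g Eg /= h3]; [by ok|by ok| |]; last first.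
  apply: wpe_skip; rewrite ifF; last by rewrite /match_at [_ + _ < _]ltnNge h3 !andbF.
  by have [|_ ->] := Eg rh h.
apply: wpe_then; apply: (wpe_assign Eg) => [|{Eg}g Eg]; first by ok.
rewrite /= in Eg; apply: wpe_then.
apply: (wpe_call (compare_spec (i := i) (i' := y - e) (l := l.+1) mS _ _ _ _) Eg); try lia.
  by apply: agr_sub Eg _; rewrite /= !eqxx.
move=> {}g m' {}Eg -> //; rewrite /= in Eg => gb.
have {gb}Eg := agr_cons Eg (isT : rb < tmp) gb.
rewrite /match_at h1 h2 h3 /=.
apply: (wpe_if Eg) => [||{Eg}g Eg /= h4|{Eg}g Eg /= h4]; try by ok.
  apply: (wpe_assign Eg) => [|g1 Eg1]; first by ok.
  by have [_ ->] := agr_head Eg1; case: mismatch h4.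
apply: wpe_skip; have [|_ ->] := Eg rh h; first by [].
by case: mismatch h4.
Qed.

Lemma digits_mem l m i : digits q l -> search_mem l m -> i < size l ->
  m (a0 + i) <= n /\ m (q0 + m (a0 + i)) = nth 0 (positions A l) i.
Proof.
move=> dl [mS mA ml] il; rewrite ml.
have /andP[h1 h2] := digits_nth dl il.
split; first exact: leq_trans h2 qn.
by rewrite (nth_map 0) // -[in LHS](prednK h1) mA //; lia.
Qed.

Lemma find_spec m lst i l g :
  digits q lst -> size lst <= X -> size lst <= n -> search_mem lst m ->
  i + l < n -> l < k ->
  agr [:: (ri, i); (rlen, l.+1); (rl, l); (rn, n); (rk, k); (rQ, q0); (rA, a0);
          (rm, size lst)] g ->
  wp w find_cmd (cost X find_cmd)
    (fun g' _ => g' rh = matched S k (positions A lst) i l) g m.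
Proof.
move=> dl lX ln sm il lk Eg; have [mS mA ml] := sm.
apply: wpe_then; apply: (wpe_assign Eg) => [|{Eg}g Eg]; first by ok.
rewrite /= in Eg.
set P := matched _ _ _ _ _; have -> : P = (if P then 1 else 0) :> nat by case: P.
rewrite /P /matched size_map.
apply: (wpe_any (B := size lst) _ _ _ _ _ _ Eg) => //; first by lia.
move=> v h {Eg}g vl Eg; have [d1 d2] := digits_mem dl sm vl.
apply: wpe_then; apply: (wpe_assign Eg) => [|{Eg}g Eg]; first by ok.
rewrite /= d2 in Eg.
set y := nth 0 (positions A lst) v in Eg *.
have yn : y < n by exact: nth_positions_lt.
apply: (wpe_any (E := [:: (ry, y); (ri, i); (rlen, l.+1); (rl, l); (rn, n); (rk, k)])
         (B := k)) => //; first by lia.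
  move=> e h' {Eg}g ek Eg; apply: (try_spec (y := y) mS) => //.
  by apply: agr_sub Eg _; rewrite /= !eqxx.
by apply: agr_sub Eg _; rewrite /= !eqxx.
Qed.

Lemma window_spec m lst x d l h g :
  digits q lst -> size lst <= X -> size lst <= n -> search_mem lst m ->
  x < n -> d < k -> l < k ->
  agr [:: (rl, l); (rf, h); (rd, d); (rx, x); (rn, n); (rk, k); (rQ, q0); (rA, a0);
          (rm, size lst)] g ->
  wp w window_cmd (cost X window_cmd)
    (fun g' _ => g' rf = if bad_at S k (positions A lst) x d l then 1 else h) g m.
Proof.
move=> dl lX ln sm xn dk lk Eg.
apply: (wpe_if Eg) => [||{Eg}g Eg /= h1|{Eg}g Eg /= h1]; try by ok.
  apply: wpe_skip; rewrite ifF; last by rewrite /bad_at leqNgt h1.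
  by have [|_ ->] := Eg rf h.
apply: (wpe_if Eg) => [||{Eg}g Eg /= h2|{Eg}g Eg /= h2]; try by ok.
  apply: wpe_skip; rewrite ifF; last by rewrite /bad_at [d <= x]leqNgt h2 andbF.
  by have [|_ ->] := Eg rf h.
apply: (wpe_if Eg) => [||{Eg}g Eg /= h3|{Eg}g Eg /= h3]; [by ok|by ok| |]; last first.
  apply: wpe_skip; rewrite ifF; last by rewrite /bad_at [_ + _ < _]ltnNge h3 !andbF.
  by have [|_ ->] := Eg rf h.
apply: wpe_then; apply: (wpe_assign Eg) => [|{Eg}g Eg]; first by ok.
rewrite /= addn1 in Eg.
apply: wpe_then; apply: (wpe_assign Eg) => [|{Eg}g Eg]; first by ok.
rewrite /= in Eg; apply: wpe_then.
apply: (wpe_call (find_spec (i := x - d) (l := l) dl lX ln sm _ lk _) Eg); try lia.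
  by apply: agr_sub Eg _; rewrite /= !eqxx.
move=> {}g m' {}Eg -> //; rewrite /= in Eg => gb.
have {gb}Eg := agr_cons Eg (isT : rh < tmp) gb.
rewrite /bad_at h1 h2 h3 /=.
apply: (wpe_if Eg) => [||{Eg}g Eg /= h4|{Eg}g Eg /= h4]; try by ok.
  apply: (wpe_assign Eg) => [|g1 Eg1]; first by ok.
  by have [_ ->] := agr_head Eg1; case: matched h4.
apply: wpe_skip; have [|_ ->] := Eg rf h; first by [].
by case: matched h4.
Qed.

Definition search_env (l : seq nat) : env :=
  [:: (rn, n); (rk, k); (rQ, q0); (rA, a0); (rq, q); (rm, size l)].

Lemma check_spec m l g :
  digits q l -> size l <= X -> size l <= n -> search_mem l m ->
  agr (search_env l) g ->
  wp w check_cmd (cost X check_cmd)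
    (fun g' _ => g' rf = bad S k A (positions A l)) g m.
Proof.
move=> dl lX ln sm Eg; have [mS mA ml] := sm.
apply: wpe_then; apply: (wpe_assign Eg) => [|{Eg}g Eg]; first by ok.
rewrite /= in Eg.
set P := bad _ _ _ _; have -> : P = (if P then 1 else 0) :> nat by case: P.
rewrite /P /bad.
apply: (wpe_any (B := q) _ _ _ _ _ _ Eg) => //; first by lia.
move=> v h {Eg}g vq Eg.
apply: wpe_then; apply: (wpe_assign Eg) => [|{Eg}g Eg]; first by ok.
rewrite /= addn1 mA // in Eg.
set x := nth 0 A v in Eg *.
have xn : x < n by apply: nth_lt_all An _.
apply: (wpe_any (E := [:: (rx, x); (rn, n); (rk, k); (rQ, q0); (rA, a0); (rm, size l)])
         (B := k)) => //; first by lia.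
  move=> d h' {Eg}g dk Eg.
  apply: (wpe_any (E := [:: (rd, d); (rx, x); (rn, n); (rk, k); (rQ, q0); (rA, a0);
         (rm, size l)]) (B := k)) => //; first by lia.
    move=> l0 h'' {Eg}g lk Eg; apply: (window_spec (x := x) dl) => //.
  by apply: agr_sub Eg _; rewrite /= !eqxx.
by apply: agr_sub Eg _; rewrite /= !eqxx.
Qed.

Lemma next_spec m l g :
  0 < q -> digits q l -> size l <= X -> size l <= n -> search_mem l m ->
  agr (search_env l) g ->
  wp w next_cmd (cost X next_cmd)
    (fun g' m' => agr (search_env (incr q l)) g' /\ search_mem (incr q l) m') g m.
Proof.
move=> qpos dl lX ln [mS mA ml] Eg.
pose J := find (fun a => a < q) l.
have Jl : J <= size l by exact: find_size.
apply: wpe_then; apply: (wpe_assign Eg) => [|{Eg}g Eg]; first by ok.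
rewrite /= in Eg; apply: wpe_then.
pose I j E m' := E = (ri, j) :: search_env l /\
  [/\ forall a, a < n -> m' a = nth 0 S a,
      forall i, i < q -> m' (q0 + i.+1) = nth 0 A i
    & forall i, m' (a0 + i) = if i < j then 1 else nth 0 l i].
have lq i : nth 0 l i <= q.
  by case: (ltnP i (size l)) => [/(digits_nth dl)/andP[]//|/(nth_default 0)->].
(* The loop resets exactly the [J] leading digits equal to [q] and stops at cell [J], possibly the 0
   past the last digit. *)
apply: (wpe_while (J := J) (I := I) _ _ _ _ _ Eg).
- by lia.
- move=> j _ m1 jJ [-> [_ _ m1l]]; have := lq j.
  split; [by ok | by ok; rewrite m1l ltnn; lia |].
  rewrite /= m1l ltnn addn1 ltnS; case: ltnP => jJ'.
    by have /negbT := before_find 0 jJ'; rewrite -leqNgt.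
  have -> : j = J by lia.
  apply/negbTE; rewrite -ltnNge; case: (ltnP J (size l)) => [Jlt|/(nth_default 0)->//].
  by apply: (nth_find 0 (a := fun a => a < q)); rewrite has_find.
- move=> j _ {Eg}g m1 jJ [-> [m1S m1A m1l]] Eg; apply: wpe_then.
  apply: (wpe_store Eg) => [||{Eg}g Eg]; [by ok|by ok|rewrite /=].
  apply: (wpe_assign Eg) => [|{Eg}g Eg]; first by ok.
  exists ((ri, j.+1) :: search_env l); last by rewrite /= addn1 in Eg.
  split=> //; rewrite /upd; split=> [a an|i iq|i].
  + by rewrite ifF ?m1S //; lia.
  + by rewrite ifF ?m1A //; lia.
  + rewrite eqn_add2l m1l ltnS; case: eqP => [->|ij]; first by rewrite leqnn.
    by rewrite [i <= j]leq_eqVlt (introF eqP ij).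
- move=> _ {Eg}g m1 [-> [m1S m1A m1l]] Eg; apply: wpe_then.
  have ml1 := m1l J; rewrite ltnn in ml1; have lJ := lq J.
  apply: (wpe_store Eg) => [||{Eg}g Eg]; [by ok|by ok; rewrite ml1; lia|].
  rewrite /= ml1.
  have sm : search_mem (incr q l) (upd m1 (a0 + J) (nth 0 l J + 1)).
    rewrite /upd; split=> [a an|i iq|i].
    + by rewrite ifF ?m1S //; lia.
    + by rewrite ifF ?m1A //; lia.
    + rewrite eqn_add2l m1l nth_incr // -/J addn1.
      by case: eqP => [->|//]; rewrite ltnn.
  apply: (wpe_if Eg) => [||{Eg}g Eg /= h1|{Eg}g Eg /= h1]; [by ok|by ok| |].
    apply: (wpe_assign Eg) => [|{Eg}g Eg]; first by ok.
    split=> //; apply: agr_sub Eg _; rewrite /= !eqxx size_incr_find -/J.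
    by rewrite (_ : maxn _ _ = J + 1) ?eqxx //; lia.
  apply: wpe_skip; split=> //; apply: agr_sub Eg _; rewrite /= !eqxx size_incr_find -/J.
  by rewrite (_ : maxn _ _ = size l) ?eqxx //; lia.
- by split=> //; split.
Qed.

Lemma search_spec r m g : 0 < q ->
  (forall r', r' <= r -> bad S k A (positions A (iter r' (incr q) [::])) = (r' < r)) ->
  size (iter r (incr q) [::]) <= X -> size (iter r (incr q) [::]) <= n ->
  search_mem [::] m -> agr (search_env [::]) g ->
  wp w search_cmd (cost X check_cmd + r.+1 * (4 + cost X (next_cmd ;; check_cmd)))
    (fun g' m' => agr (search_env (iter r (incr q) [::])) g' /\
                  search_mem (iter r (incr q) [::]) m') g m.
Proof.
move=> qpos + rX rn sm Eg; pose L r := iter r (incr q) [::].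
rewrite -/(L r) in rX rn * => bL.
have dL r' : digits q (L r') by have [] := rank_iter_incr r' qpos.
have sL r' : r' <= r -> size (L r') <= size (L r) by exact: size_iter_incr.
pose I j E m' := E = (rf, nat_of_bool (j < r)) :: search_env (L j) /\ search_mem (L j) m'.
apply: wp_then.
apply: (wpe_call (check_spec (dL 0) _ _ sm Eg) Eg); rewrite ?/L //.
move=> {}g m1 {}Eg -> // gf; rewrite bL // in gf.
apply: (wpe_while_gen (I := I) (E := (rf, nat_of_bool (0 < r)) :: search_env (L 0))).
- move=> j _ m2 jr [-> _]; split; [by ok|by ok|].
  by rewrite /=; case: (j < r).
- move=> j _ {Eg gf}g m2 jr [-> sm2] Eg; apply: wpe_then.
  have := sL j (ltnW jr); have := sL j.+1 jr => s1 s0.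
  have Eg' : agr (search_env (L j)) g by apply: agr_sub Eg _; rewrite /= !eqxx.
  apply: (wpe_call (next_spec qpos (dL j) _ _ sm2 Eg') Eg'); try lia.
  move=> {Eg Eg'}g m3 _ _ [Eg sm3].
  apply: (wpe_call (check_spec (dL j.+1) _ _ sm3 Eg) Eg); try (rewrite -/(L j.+1); lia).
  move=> {}g m4 {}Eg -> // gf; rewrite (bL j.+1) // in gf.
  exists ((rf, nat_of_bool (j.+1 < r)) :: search_env (L j.+1)) => //.
  exact: agr_cons.
- move=> _ {Eg gf}g m2 [-> sm2] Eg; split=> //.
  by apply: agr_sub Eg _; rewrite /= !eqxx.
- by split.
- exact: agr_cons.
Qed.

Lemma output_spec l m g : digits q l -> size l <= X -> size l <= n ->
  search_mem l m -> agr (search_env l) g ->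
  wp w output_cmd (cost X output_cmd)
    (fun g' m' => [/\ g' 0 = size l, g' 1 = a0 &
       forall i, i < size l -> m' (a0 + i) = (nth 0 (positions A l) i).+1]) g m.
Proof.
move=> dl lX ln [mS mA ml] Eg; apply: wpe_then.
pose I v E m' := E = search_env l /\
  (forall i, i < q -> m' (q0 + i.+1) = nth 0 A i) /\
  (forall i, i < size l ->
     m' (a0 + i) = if i < v then (nth 0 (positions A l) i).+1 else nth 0 l i).
apply: (wpe_for (B := size l) (I := I) _ _ _ _ _ _ _ Eg) => //.
- by lia.
- by move=> v _ m1 [-> _].
- move=> v _ {Eg}g m1 vl [-> [m1A m1l]] Eg.
  have /andP[d1 d2] := digits_nth dl vl.
  have e1 : m1 (a0 + v) = nth 0 l v by rewrite m1l // ltnn.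
  have e2 : m1 (q0 + nth 0 l v) = nth 0 (positions A l) v.
    by rewrite (nth_map 0) // -[in LHS](prednK d1) m1A //; lia.
  have pn := nth_positions_lt An dl vl.
  apply: (wpe_store Eg) => [||{Eg}g Eg].
  + by ok.
  + by ok; rewrite ?e1 ?e2; lia.
  exists (search_env l) => //; split=> //; rewrite /= e1 e2 /upd; split=> [i iq|i il].
    by rewrite ifF ?m1A //; lia.
  rewrite eqn_add2l m1l // ltnS; case: eqP => [->|iv]; first by rewrite leqnn addn1.
  by rewrite [i <= v]leq_eqVlt (introF eqP iv).
- move=> _ {Eg}g m1 [-> [m1A m1l]] Eg; apply: wpe_then.
  apply: (wpe_assign Eg) => [|{Eg}g Eg]; first by ok.
  apply: (wpe_assign Eg) => [|{Eg}g Eg]; first by ok.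
  split.
  + by have [|_ ->] := Eg 0 (size l).
  + by have [|_ ->] := Eg 1 a0.
  + by move=> i il; rewrite m1l // il.
Qed.

End Search.

(** * Representatives of the contexts *)

(** Minimality among sequences excludes repetitions: otherwise the attractor listed by [L] would
    have fewer elements than [L] has entries, and its enumeration would be a shorter cover. *)
Lemma min_attractor_seq S k L : all (fun p => p < size S) L -> covers S k L ->
  (forall G, all (fun p => p < size S) G -> covers S k G -> size L <= size G) ->
  uniq (map succn L) /\ is_min_attractor k S [fset p in map succn L]%fset.
Proof.
move=> Ln cov mn; have att := covers_attractor Ln cov.
have mn' (G : {fset nat}) : is_attractor k S G -> size L <= #|` G|.
  by move=> /attractor_covers[Gn covG]; have := mn _ Gn covG; rewrite size_map.
have card : #|` [fset p in map succn L]%fset| = size (undup (map succn L)).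
  by rewrite card_fseq.
split; last first.
  split=> // G /mn'; apply: leq_trans.
  by rewrite card -(size_map succn L) size_undup.
by rewrite -[uniq _]negbK -ltn_size_undup -card -leqNgt size_map; apply: mn'.
Qed.

(** Here [r] is the least rank of a cover by representatives; one exists because the set of all
    positions is a cover. Any cover [G] yields a candidate of the same length, whose rank is at
    least [r], and this bounds both the length of the sequence found and [r]. *)
Lemma first_cover S k A : 0 < size A ->
  (forall p, p < size S -> exists2 p', p' \in A & sim S k p p') ->
  exists r, (forall r', r' <= r ->
      bad S k A (positions A (iter r' (incr (size A)) [::])) = (r' < r)) /\
    forall G, all (fun p => p < size S) G -> covers S k G ->
      size (iter r (incr (size A)) [::]) <= size G /\ r < (size A).+1 ^ size G.
Proof.
move=> q0 rep; set q := size A in q0 *.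
pose good r := ~~ bad S k A (positions A (iter r (incr q) [::])).
have key G : all (fun p => p < size S) G -> covers S k G ->
    exists l, [/\ digits q l, size l = size G & good (rank q l)].
  move=> Gn cov; have [G' [sz sub cov']] := covers_reps rep Gn cov.
  exists [seq (index y A).+1 | y <- G'].
  have dl : digits q [seq (index y A).+1 | y <- G'].
    by apply/allP => _ /mapP[y /sub yA ->]; rewrite /= index_mem.
  split=> //; first by rewrite size_map.
  rewrite /good iter_incr_rank //; apply/(badP _ rep).
  suff -> : positions A [seq (index y A).+1 | y <- G'] = G' by [].
  rewrite /positions -map_comp -[RHS]map_id; apply/eq_in_map => y /sub yA /=.
  exact: nth_index.
have [|l0 [_ _ ex0]] := key (iota 0 (size S)) _ (@covers_iota S k).
  by apply/allP => p; rewrite mem_iota.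
have ex : exists r, good r by exists (rank q l0).
case: (ex_minnP ex) => r gr rmin; exists r; split=> [r' r'r|G Gn cov].
  have [r'lt|] := ltnP r' r; last by move=> rr'; apply/negbTE; have -> : r' = r by lia.
  by apply: contraTT r'lt => /rmin; rewrite -leqNgt.
have [l [dl sl gl]] := key G Gn cov; have rl := rmin _ gl; rewrite -sl.
split; last exact: leq_ltn_trans rl (rank_lt dl).
by rewrite -[in leqRHS](iter_incr_rank q0 dl); apply: size_iter_incr.
Qed.

(* Leaves [minn (sigma ^ k) n.+1] in [rN]: the test is true exactly when the next
   power would exceed [n], and stays true afterwards. *)
Definition power_cmd : cmd :=
  rN <~ Cst 1 ;;
  For rj rk (IfLt (Bin Div (Var rn) (Var rs)) (Var rN)
    (rN <~ Var rn [+] Cst 1) (rN <~ Var rN [*] Var rs)).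

Definition roll_cmd : cmd :=
  rB <~ Var rs [+] Cst 1 ;; rD <~ Cst 1 ;;
  For rj rk (rD <~ Var rD [*] (Var rB [*] Var rB)) ;;
  rE <~ Cst 1 ;; rF <~ Cst 0.

(* With these parameters the code of the position [p] is [p + k]. *)
Definition count_cmd : cmd :=
  rB <~ Cst 1 ;; rD <~ Var rn [+] Var rn [+] Cst 1 ;; rE <~ Cst 0 ;; rF <~ Cst 1.

(* Memory: [S] at [0], zeros up to [2 n], the representatives at [2 n + 1], the table of
   the codes met so far at [3 n + 1], and after it the digits of the search. The code read
   after [S[p + k]] is that of the 0-based position [p]. *)
Definition scan_cmd : cmd :=
  rQ <~ Var rn [+] Var rn ;; rT <~ Var rQ [+] Var rn [+] Cst 1 ;; rA <~ Var rT [+] Var rD ;;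
  rtb <~ Var rn [+] Var rk [-] Cst 1 ;; rc <~ Cst 0 ;; rq <~ Cst 0 ;;
  For rt rtb
    (rc <~ Bin Mod (Var rc [*] Var rB [+] (Fetch (Var rt) [*] Var rE [+] Var rF)) (Var rD) ;;
     IfLt (Var rt [+] Cst 1) (Var rk) Skip
     (IfLt (Fetch (Var rT [+] Var rc)) (Cst 1)
       (Store (Var rT [+] Var rc) (Cst 1) ;; rq <~ Var rq [+] Cst 1 ;;
        Store (Var rQ [+] Var rq) (Var rt [+] Cst 1 [-] Var rk))
       Skip)) ;;
  rm <~ Cst 0.

Definition setup_cmd : cmd :=
  IfLt (Var rn) (Var rk) (rk <~ Var rn) Skip ;;
  power_cmd ;; IfLt (Var rn) (Var rN) count_cmd roll_cmd ;; scan_cmd.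

Definition main_cmd : cmd :=
  IfLt (Var rs) (Cst 2) (rn <~ Cst 1 ;; rs <~ Cst 0)
    (setup_cmd ;; search_cmd ;; output_cmd).

(** * Specifications of the preprocessing *)

Section Setup.

Variables (w : nat) (S : seq nat) (sigma k : nat).
Notation n := (size S).
Notation s := (nth 0 S).

Hypothesis k0 : 0 < k.
Hypothesis kn : k <= n.

Lemma power_spec m g : 1 < sigma -> n.+1 < 2 ^ w ->
  agr [:: (rk, k); (rn, n); (rs, sigma)] g ->
  wp w power_cmd (cost (2 * n) power_cmd)
    (fun g' _ => g' rN = minn (sigma ^ k) n.+1) g m.
Proof.
move=> s1 nw Eg.
apply: wpe_then; apply: (wpe_assign Eg) => [|{Eg}g Eg]; first by ok.
pose I v E (m' : nat -> nat) :=
  E = [:: (rN, minn (sigma ^ v) n.+1); (rk, k); (rn, n); (rs, sigma)].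
apply: (wpe_for (B := k) (I := I) _ _ _ _ _ _ _ Eg) => //; try lia.
- by move=> v _ m1 ->.
- move=> v _ {Eg}g m1 vk -> Eg.
  have dE x : (n %/ sigma < x) = (n < x * sigma) by rewrite ltn_divLR //; lia.
  apply: (wpe_if Eg) => [||{Eg}g Eg /=|{Eg}g Eg /=]; [by ok|by ok| |].
    rewrite dE => h; apply: (wpe_assign Eg) => [|{Eg}g Eg]; first by ok.
    eexists; first by [].
    apply: agr_sub Eg _; rewrite /= !eqxx /= andbT; apply/eqP; congr Some.
    rewrite expnSr; have : minn (sigma ^ v) n.+1 * sigma <= sigma ^ v * sigma.
      by rewrite leq_mul2r geq_minl orbT.
    lia.
  rewrite leqNgt dE -leqNgt => h.
  have h' : minn (sigma ^ v) n.+1 = sigma ^ v.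
    have := leq_mul (leqnn (minn (sigma ^ v) n.+1)) s1; lia.
  apply: (wpe_assign Eg) => [|{Eg}g Eg]; first by ok.
  eexists; first by [].
  apply: agr_sub Eg _; rewrite /= !eqxx /= andbT; apply/eqP; congr Some.
  by rewrite h' in h *; rewrite expnSr; lia.
- by move=> _ {Eg}g m1 -> Eg; have [] := agr_head Eg.
- by rewrite /I /= expn0 minnSS min0n.
Qed.

Lemma roll_spec m g : sigma.+1 ^ (2 * k) < 2 ^ w -> k < 2 ^ w ->
  agr [:: (rk, k); (rn, n); (rs, sigma)] g ->
  wp w roll_cmd (cost (2 * n) roll_cmd)
    (fun g' _ => agr [:: (rB, sigma.+1); (rD, sigma.+1 ^ (2 * k)); (rE, 1); (rF, 0)] g')
    g m.
Proof.
move=> Bw kw Eg; have w1 : 1 < 2 ^ w by apply: leq_trans Bw; rewrite ltnS expn_gt0.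
have BB : sigma.+1 ^ 2 <= sigma.+1 ^ (2 * k) by rewrite leq_pexp2l //; lia.
have B2 : sigma.+1 <= sigma.+1 * sigma.+1 by rewrite leq_pmulr.
rewrite -mulnn in BB.
apply: wpe_then; apply: (wpe_assign Eg) => [|{Eg}g Eg]; first by ok.
rewrite /= addn1 in Eg.
apply: wpe_then; apply: (wpe_assign Eg) => [|{Eg}g Eg]; first by ok.
rewrite /= in Eg; apply: wpe_then.
pose I v E (m' : nat -> nat) :=
  E = [:: (rD, sigma.+1 ^ (2 * v)); (rB, sigma.+1); (rk, k); (rn, n); (rs, sigma)].
apply: (wpe_for (B := k) (I := I) _ _ _ _ _ _ _ Eg) => //; try lia.
- by move=> v _ m1 ->.
- move=> v _ {Eg}g m1 vk -> Eg.
  have e : sigma.+1 ^ (2 * v) * (sigma.+1 * sigma.+1) = sigma.+1 ^ (2 * v.+1).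
    by rewrite mulnn -expnD mulnS addnC.
  have h : sigma.+1 ^ (2 * v.+1) <= sigma.+1 ^ (2 * k) by rewrite leq_pexp2l //; lia.
  apply: (wpe_assign Eg) => [|{Eg}g Eg]; first by ok; rewrite e; lia.
  eexists; first by [].
  by apply: agr_sub Eg _; rewrite /= e !eqxx.
- move=> _ {Eg}g m1 -> Eg.
  apply: wpe_then; apply: (wpe_assign Eg) => [|{Eg}g Eg]; first by ok.
  apply: (wpe_assign Eg) => [|{Eg}g Eg]; first by ok.
  by apply: agr_sub Eg _; rewrite /= !eqxx.
Qed.

Lemma count_spec m g : 2 * n.+1 < 2 ^ w ->
  agr [:: (rk, k); (rn, n); (rs, sigma)] g ->
  wp w count_cmd (cost (2 * n) count_cmd)
    (fun g' _ => agr [:: (rB, 1); (rD, (2 * n).+1); (rE, 0); (rF, 1)] g') g m.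
Proof.
move=> nw Eg.
apply: wpe_then; apply: (wpe_assign Eg) => [|{Eg}g Eg]; first by ok.
apply: wpe_then; apply: (wpe_assign Eg) => [|{Eg}g Eg]; first by ok.
apply: wpe_then; apply: (wpe_assign Eg) => [|{Eg}g Eg]; first by ok.
apply: (wpe_assign Eg) => [|{Eg}g Eg]; first by ok.
by apply: agr_sub Eg _; rewrite /= addnn -mul2n addn1 !eqxx.
Qed.

Section Scan.

Variables B D Ec Fc : nat.
Notation code p := (rolling S B D Ec Fc (p + k)).

Hypothesis D0 : 0 < D.
Hypothesis Dw : D + 5 * n.+1 < 2 ^ w.
Hypothesis codew : forall c i, c < D -> c * B + (s i * Ec + Fc) < 2 ^ w.

Lemma uniq_map_size_le (f : nat -> nat) A b :
  uniq (map f A) -> all (fun p => p < b) A -> size A <= b.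
Proof.
move=> /map_uniq uA Ab; rewrite -(size_iota 0 b); apply: uniq_leq_size => // p /(allP Ab).
by rewrite mem_iota.
Qed.

Let base : env := [:: (rtb, n + k - 1); (rn, n); (rk, k); (rB, B); (rD, D); (rE, Ec);
  (rF, Fc); (rQ, 2 * n); (rT, (3 * n).+1); (rA, (3 * n).+1 + D)].

(** The first clause goes beyond [n] because the codes of the last positions involve zeros read
    after the string. The last clause concerns the positions whose code is complete after [v]
    letters. *)
Definition scan_inv (v : nat) (A : seq nat) (m : nat -> nat) : Prop :=
  [/\ forall a, a < 2 * n -> m a = s a,
      forall i, i < size A -> m (2 * n + i.+1) = nth 0 A i,
      forall c, c < D -> m ((3 * n).+1 + c) = (c \in [seq code p | p <- A]) &
      forall i, m ((3 * n).+1 + D + i) = 0] /\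
  [/\ uniq [seq code p | p <- A],
      all (fun p => p < n) A &
      forall p, p + k <= v -> code p \in [seq code p | p <- A]].

Lemma rolling_lt t : rolling S B D Ec Fc t < D.
Proof. by case: t => [|t] //=; rewrite ltn_mod. Qed.

Lemma scan_spec m g :
  (forall a, m a = s a) ->
  agr [:: (rn, n); (rk, k); (rB, B); (rD, D); (rE, Ec); (rF, Fc)] g ->
  wp w scan_cmd (cost (2 * n) scan_cmd)
    (fun g' m' => exists A,
       [/\ agr (search_env S A k (2 * n) ((3 * n).+1 + D) [::]) g',
           search_mem S A (2 * n) ((3 * n).+1 + D) [::] m',
           size A <= minn n D,
           all (fun p => p < n) A &
           forall p, p < n -> exists2 p', p' \in A & code p = code p']) g m.
Proof.
move=> mS Eg.
apply: wpe_then; apply: (wpe_assign Eg) => [|{Eg}g Eg]; first by ok.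
rewrite /= addnn -mul2n in Eg.
apply: wpe_then; apply: (wpe_assign Eg) => [|{Eg}g Eg]; first by ok.
rewrite /= -mulSnr addn1 in Eg.
apply: wpe_then; apply: (wpe_assign Eg) => [|{Eg}g Eg]; first by ok.
apply: wpe_then; apply: (wpe_assign Eg) => [|{Eg}g Eg]; first by ok.
apply: wpe_then; apply: (wpe_assign Eg) => [|{Eg}g Eg]; first by ok.
apply: wpe_then; apply: (wpe_assign Eg) => [|{Eg}g Eg]; first by ok.
rewrite /= in Eg; apply: wpe_then.
pose I v E m' := exists2 A,
  E = [:: (rc, rolling S B D Ec Fc v), (rq, size A) & base] & scan_inv v A m'.
apply: (wpe_for (B := n + k - 1) (I := I)
  (E := [:: (rc, 0), (rq, 0) & base])) => //; try lia.
- by move=> v _ m1 [A -> _].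
- move=> v _ {Eg}g m1 vb [A -> [[m1S m1A m1T m10] [uA An cA]]] Eg.
  have Aq := uniq_map_size_le uA An.
  have cw := codew v (rolling_lt v).
  have m1v : m1 v = s v by apply: m1S; lia.
  apply: wpe_then; apply: (wpe_assign Eg) => [|{Eg}g Eg].
    by ok; rewrite ?m1v; move: cw; lia.
  rewrite /= m1v -/(rolling S B D Ec Fc v.+1) in Eg.
  set c := rolling S B D Ec Fc v.+1 in Eg.
  have cD : c < D by exact: rolling_lt.
  apply: (wpe_if Eg) => [||{Eg}g Eg /= h1|{Eg}g Eg /= h1]; [by ok|by ok| |].
    (* Fewer than [k] letters have been read, so no code is complete. *)
    apply: wpe_skip; exists [:: (rc, c), (rq, size A) & base].
      exists A => //; split=> //; split=> // p pv; apply: cA; lia.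
    by apply: agr_sub Eg _; rewrite /= !eqxx.
  have cE : c = code (v.+1 - k) by rewrite /c; congr rolling; lia.
  apply: (wpe_if Eg) => [||{Eg}g Eg /= |{Eg}g Eg /=]; [by ok|by ok| |]; rewrite m1T //.
    case cA': (c \in _) => // _.
    apply: wpe_then; apply: (wpe_store Eg) => [||{Eg}g Eg]; [by ok|by ok|].
    apply: wpe_then; apply: (wpe_assign Eg) => [|{Eg}g Eg]; first by ok.
    rewrite /= addn1 in Eg.
    have uA' : uniq [seq code p | p <- rcons A (v.+1 - k)].
      by rewrite map_rcons rcons_uniq uA -cE cA'.
    have An' : all (fun p => p < n) (rcons A (v.+1 - k)).
      by rewrite all_rcons An andbT; lia.
    have := uniq_map_size_le uA' An'; rewrite size_rcons => Aq'.
    apply: (wpe_store Eg) => [||{Eg}g Eg]; [by ok|by ok|].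
    exists [:: (rc, c), (rq, (size A).+1) & base]; last first.
      by apply: agr_sub Eg _; rewrite /= !eqxx.
    exists (rcons A (v.+1 - k)); first by rewrite size_rcons.
    rewrite /= addn1 /upd; split; split=> //.
    + by move=> a an; rewrite ifF ?ifF ?m1S //; lia.
    + move=> i; rewrite size_rcons ltnS leq_eqVlt => /predU1P[->|iA].
        by rewrite eqxx nth_rcons ltnn eqxx.
      rewrite ifF; last by lia.
      by rewrite ifF; [rewrite m1A // nth_rcons iA|lia].
    + move=> c' cD'; rewrite ifF; last by lia.
      rewrite eqn_add2l map_rcons mem_rcons inE -cE m1T //.
      by case: eqP.
    + by move=> i; rewrite ifF ?ifF //; lia.
    + move=> p; rewrite map_rcons mem_rcons inE => pv.
      have [e|pv'] : v.+1 - k = p \/ p + k <= v by lia.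
        by rewrite e eqxx.
      by rewrite cA // orbT.
  case cA': (c \in _) => // _.
  apply: wpe_skip; exists [:: (rc, c), (rq, size A) & base]; last first.
    by apply: agr_sub Eg _; rewrite /= !eqxx.
  exists A => //; split=> //; split=> // p pv.
  have [e|pv'] : v.+1 - k = p \/ p + k <= v by lia.
    by rewrite -e -cE.
  exact: cA.
- move=> _ {Eg}g m1 [A -> [[m1S m1A m1T m10] [uA An cA]]] Eg.
  apply: (wpe_assign Eg) => [|{Eg}g Eg]; first by ok.
  exists A; split=> //.
  + by apply: agr_sub Eg _; rewrite /= !eqxx.
  + by split=> // [a an|i]; [apply: m1S; lia|rewrite m10 nth_nil].
  (* Both bounds are pigeonhole arguments: distinct positions below [n], distinct codes below
     [D]. *)
  + rewrite leq_min (uniq_map_size_le uA An) /= -(size_map (fun p => code p)).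
    rewrite -[in leqRHS](size_iota 0 D); apply: uniq_leq_size => // _ /mapP[p _ ->].
    by rewrite mem_iota rolling_lt.
  + move=> p pn; have /mapP[p' pA e] : code p \in [seq code p | p <- A].
      by apply: cA; lia.
    by exists p'.
- exists [::] => //; split; split=> //.
  + by move=> c cD; rewrite mS nth_default //; lia.
  + by move=> i; rewrite mS nth_default //; lia.
  + by move=> p; lia.
- by apply: agr_sub Eg _; rewrite /= !eqxx.
Qed.

End Scan.

End Setup.

(** * Word sizes, correctness and time of the combined commands *)

Section Main.

Variables (w : nat) (S : seq nat) (sigma k : nat).
Notation n := (size S).

Hypothesis n0 : 0 < n.
Hypothesis k0 : 0 < k.
Hypothesis dS : digits sigma S.
Hypothesis nw : n.+1 ^ 7 <= 2 ^ w.
Hypothesis s1 : 1 < sigma.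
Hypothesis sw : sigma < 2 ^ w.
Hypothesis kw : k < 2 ^ w.

Let k' := minn k n.
Let N := sigma ^ k'.

Let k'0 : 0 < k'. Proof. by rewrite leq_min k0. Qed.

Lemma N_ge2 : 1 < N.
Proof. by rewrite -(exp1n k') ltn_exp2r. Qed.

Lemma k_lt_N : k' < N.
Proof. exact: ltn_expl. Qed.

(** The exponent 7 splits as [3 + 4]: the factor 8 above [n.+1 ^ 4] leaves room for the addresses
    around the table. The bound with 6 is for the product of a code and the base. *)
Lemma word_bound : 8 * n.+1 ^ 4 <= 2 ^ w /\ n.+1 ^ 6 < 2 ^ w.
Proof.
have n2 : 2 <= n.+1 by [].
split; apply: leq_trans nw.
  by rewrite -[7]/(3 + 4) expnD leq_mul2r; apply/orP; right; rewrite (@leq_exp2r 2 _ 3).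
by rewrite ltn_exp2l.
Qed.

Lemma letter_lt i : nth 0 S i < sigma.+1.
Proof.
case: (ltnP i n) => [iS|/(nth_default 0) ->//].
by have /andP[] := digits_nth dS iS.
Qed.

Lemma letter_gt0 i : i < n -> 0 < nth 0 S i.
Proof. by move=> iS; have /andP[] := digits_nth dS iS. Qed.

(** The exponent 4 comes from [2 * k'] digits and [sigma.+1 <= sigma ^ 2]. *)
Lemma roll_modulus_le : sigma.+1 ^ (2 * k') <= N ^ 4.
Proof.
have -> : N ^ 4 = (sigma ^ 2) ^ (2 * k') by rewrite -!expnM; congr expn; lia.
by rewrite leq_exp2r ?muln_gt0 //; have := leq_mul s1 (leqnn sigma); rewrite -mulnn; lia.
Qed.

Lemma setup_spec m g :
  (forall a, m a = nth 0 S a) -> agr [:: (rn, n); (rs, sigma); (rk, k)] g ->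
  wp w setup_cmd (cost (2 * n) setup_cmd)
    (fun g' m' => exists A a0,
       [/\ agr (search_env S A k' (2 * n) a0 [::]) g',
           search_mem S A (2 * n) a0 [::] m',
           3 * n < a0 /\ a0 + n.+1 < 2 ^ w,
           size A <= n /\ size A <= N ^ 4 &
           all (fun p => p < n) A /\
           forall p, p < n -> exists2 p', p' \in A & sim S k' p p']) g m.
Proof.
move=> mS Eg; have [w4 w6] := word_bound; have N1 := N_ge2; have kN := k_lt_N.
have n4 : n.+1 <= n.+1 ^ 4 by rewrite -[leqLHS]expn1 leq_exp2l.
have k'n : k' <= n by exact: geq_minr.
apply: wpe_then.
apply: (wp_post (Q := fun g' m' => m' = m /\ agr [:: (rk, k'); (rn, n); (rs, sigma)] g')).
  apply: (wpe_if Eg) => [||{Eg}g Eg /= h|{Eg}g Eg /= h]; [by ok|by ok| |].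
    apply: (wpe_assign Eg) => [|{Eg}g Eg]; first by ok.
    split=> //; apply: agr_sub Eg _; rewrite /= !eqxx /= andbT.
    by apply/eqP; congr Some; rewrite /k'; lia.
  apply: wpe_skip; split=> //; apply: agr_sub Eg _; rewrite /= !eqxx /= andbT.
  by apply/eqP; congr Some; rewrite /k'; lia.
move=> {Eg}g _ [-> Eg]; apply: wpe_then.
apply: (wpe_call (power_spec k'0 k'n m s1 _ Eg) Eg) => //; try lia.
move=> {Eg}g _ Eg -> // gN; rewrite /= in Eg.
have {gN}Eg := agr_cons Eg (isT : rN < tmp) gN; rewrite -/N in Eg.
apply: wpe_then.
(* What the scan needs from either choice of parameters. The bound on [minn n D] holds through [n]
   when [n < N], and through [D] otherwise. *)
pose params B D Ec Fc := [/\ 0 < D, D + 5 * n.+1 < 2 ^ w,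
  forall c i, c < D -> c * B + (nth 0 S i * Ec + Fc) < 2 ^ w,
  minn n D <= N ^ 4 &
  forall p p', p < n -> p' < n ->
    rolling S B D Ec Fc (p + k') = rolling S B D Ec Fc (p' + k') -> sim S k' p p'].
apply: (wp_post (Q := fun g' m' => m' = m /\ exists B D Ec Fc,
  agr [:: (rn, n); (rk, k'); (rB, B); (rD, D); (rE, Ec); (rF, Fc)] g' /\
  params B D Ec Fc)).
  apply: (wpe_if Eg) => [||{Eg}g Eg /= h|{Eg}g Eg /= h]; [by ok|by ok| |].
    apply: (wpe_call (count_spec (sigma := sigma) k'0 k'n m _ _) Eg); try lia.
      by apply: agr_sub Eg _; rewrite /= !eqxx.
    move=> {Eg}g _ Eg -> // Eg'; rewrite /= in Eg; split=> //.
    exists 1, (2 * n).+1, 0, 1; split.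
      by apply: agr_sub (agr_cat Eg Eg') _; rewrite /= !eqxx.
    split=> //; [by lia|by move=> c i cD; rewrite muln0; lia| |].
    + have : N <= N ^ 4 by rewrite -[leqLHS]expn1 leq_exp2l.
      lia.
    + move=> p p' pn pn'; rewrite !rolling_count; try lia.
      by move=> /addIn ->; apply: sim_refl.
  have Nn : N <= n by lia.
  have Nn4 : N ^ 4 <= n.+1 ^ 4 by rewrite leq_exp2r // ltnW.
  have Bn : sigma.+1 <= n.+1.
    by rewrite ltnS; apply: leq_trans Nn; rewrite -[leqLHS]expn1 leq_exp2l.
  have D4 := roll_modulus_le.
  apply: (wpe_call (roll_spec (sigma := sigma) k'0 k'n m _ _ _) Eg) => //; try lia.
    by apply: agr_sub Eg _; rewrite /= !eqxx.
  move=> {Eg}g _ Eg -> // Eg'; rewrite /= in Eg; split=> //.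
  exists sigma.+1, (sigma.+1 ^ (2 * k')), 1, 0; split.
    by apply: agr_sub (agr_cat Eg Eg') _; rewrite /= !eqxx.
  split; [by rewrite expn_gt0|by lia| |by lia|].
  + move=> c i cD; rewrite muln1 addn0.
    have h1 := leq_mul cD (leqnn sigma.+1); have h2 := letter_lt i.
    have h3 := leq_mul (leq_trans D4 Nn4) Bn; rewrite -[leqRHS]expnSr in h3.
    have h4 : n.+1 ^ 5 <= n.+1 ^ 6 by rewrite leq_exp2l.
    by move: h1; rewrite mulSn; lia.
  + move=> p p' pn pn' e; apply: (rolling_sim (B := sigma.+1)) e => //.
      exact: letter_lt.
    exact: letter_gt0.
move=> {Eg}g _ [-> [B [D [Ec [Fc [Eg [D0 Dw cw D4 rep]]]]]]].
apply: wp_post (scan_spec k'0 k'n D0 Dw cw mS Eg) _ => // g' m' [A [Eg' sm sA An repA]].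
exists A, ((3 * n).+1 + D); split=> //; try lia.
split=> // p pn; have [p' pA e] := repA p pn; exists p' => //.
by apply: rep e => //; apply: (allP An).
Qed.

Definition solution (g m : nat -> nat) : Prop := exists L,
  [/\ all (fun p => p < n) L, covers S k L,
      forall G, all (fun p => p < n) G -> covers S k G -> size L <= size G,
      g 0 = size L & forall i, i < size L -> m (g 1 + i) = (nth 0 L i).+1].

Definition search_time : nat :=
  cost (N ^ 4) check_cmd + N ^ (10 * N) * (4 + cost (N ^ 4) (next_cmd ;; check_cmd)).

Lemma leq_expn2r a b e : a <= b -> a ^ e <= b ^ e.
Proof. by case: e => // e ab; rewrite leq_exp2r. Qed.

Lemma succ_N4_le : (N ^ 4).+1 <= N ^ 5.
Proof. by rewrite ltn_exp2l // N_ge2. Qed.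

Lemma double_N_le : 2 * N <= N ^ 4.
Proof.
have N1 := N_ge2; apply: (@leq_trans (N * N)); first by rewrite leq_mul2r N1 orbT.
by rewrite mulnn leq_exp2l.
Qed.

Lemma solve_spec m g :
  (forall a, m a = nth 0 S a) -> agr [:: (rn, n); (rs, sigma); (rk, k)] g ->
  wp w (setup_cmd ;; search_cmd ;; output_cmd)
    (cost (2 * n) setup_cmd + (search_time + cost n output_cmd)) solution g m.
Proof.
move=> mS Eg; have [w4 w6] := word_bound; have N1 := N_ge2; have kN := k_lt_N.
have n4 : n.+1 <= n.+1 ^ 4 by rewrite -[leqLHS]expn1 leq_exp2l.
have N4 : N <= N ^ 4 by rewrite -[leqLHS]expn1 leq_exp2l.
have k'n : k' <= n by exact: geq_minr.
apply: wp_then; apply: wp_post (setup_spec mS Eg) _ => {m mS Eg}g m.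
move=> [A [a0 [Eg sm [a1 a2] [qn qN] [An rep]]]].
have q0 : 0 < size A by have [p' + _] := rep 0 n0; case: (A).
have [r [bad_r best]] := first_cover q0 rep.
(* Two covers are compared with the result: all positions, so that its length is at most [n] and the
   digits stay within the address range; then a small cover, for bounds in [N] alone. *)
have [iL iT] := best (iota 0 n) (ltac:(by apply/allP => p; rewrite mem_iota))
   (@covers_iota S k').
have [G [sG Gn cG]] := covers_exp_size k' s1 dS; have [eL eT] := best G Gn cG.
rewrite size_iota in iL; have L2 := leq_trans eL sG; rewrite -/N in sG L2.
(* The base [(size A).+1] is at most [N ^ 5] and the exponent [size G] at most [2 * N]. *)
have rT : r.+1 <= N ^ (10 * N).
  apply: leq_trans eT _; apply: (@leq_trans ((N ^ 5) ^ size G)).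
    by apply: leq_expn2r; apply: leq_trans succ_N4_le.
  by rewrite -expnM leq_exp2l //; lia.
set l := iter r (incr (size A)) [::] in iL eL L2 *.
have dl : digits (size A) l by have [] := rank_iter_incr r q0.
have l4 := leq_trans L2 double_N_le.
apply: wp_then; apply: (@wp_weaken _ _
   (cost (N ^ 4) check_cmd + r.+1 * (4 + cost (N ^ 4) (next_cmd ;; check_cmd)))
   _ (fun g' m' => agr (search_env S A k' (2 * n) a0 l) g' /\
                  search_mem S A (2 * n) a0 l m')).
- by apply: search_spec => //; lia.
- by rewrite leq_add2l leq_mul2r rT orbT.
move=> {Eg}g {sm}m' _ _ [Eg sm].
apply: wp_post (output_spec (X := n) _ _ _ _ _ _ _ _ _ An dl _ _ sm Eg) _ => //; try lia.
move=> {Eg}g {sm}m'' [g0 g1 mL]; exists (positions A l); rewrite size_map.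
have cov : covers S k' (positions A l) by apply/(badP _ rep); rewrite bad_r ?ltnn.
split=> //.
- apply/(all_nthP 0) => i; rewrite size_map; exact: nth_positions_lt.
- exact/covers_minn.
- by move=> G' G'n /covers_minn cG'; have [] := best G' G'n cG'.
- by move=> i il; rewrite g1 mL.
Qed.

(** A test has six nested loops of at most [N ^ 4] iterations, whence [N ^ 30]; 161 and 201 bound
    code sizes. All constants fit in [512 = 2 ^ 9 <= N ^ 9], and [10 * N + 9 + 30 <= 49 * N]. *)
Lemma search_time_le : search_time <= N ^ (49 * N).
Proof.
have N1 := N_ge2.
have X6 : (N ^ 4).+1 ^ 6 <= N ^ 30.
  by rewrite (expnM N 5 6); apply: leq_expn2r; apply: succ_N4_le.
have c1 : cost (N ^ 4) check_cmd <= 161 * N ^ 30.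
  by apply: leq_trans (cost_le _ _) _; apply: leq_mul.
have c2 : cost (N ^ 4) (next_cmd ;; check_cmd) <= 201 * N ^ 30.
  by apply: leq_trans (cost_le _ _) _; apply: leq_mul.
have p1 : 0 < N ^ 30 by rewrite expn_gt0 ltnW.
have p2 : 0 < N ^ (10 * N) by rewrite expn_gt0 ltnW.
apply: (@leq_trans (N ^ (10 * N) * (512 * N ^ 30))).
  rewrite /search_time; apply: (@leq_trans (N ^ (10 * N) * (161 * N ^ 30) +
    N ^ (10 * N) * (4 + 201 * N ^ 30))).
    apply: leq_add; last by rewrite leq_mul2l leq_add2l c2 orbT.
    by apply: leq_trans c1 _; rewrite leq_pmull.
  by rewrite -mulnDr leq_mul2l; apply/orP; right; move: (N ^ 30) p1 => x; clear; lia.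
have h : 512 <= N ^ 9 by rewrite -[512]/(2 ^ 9); apply: leq_expn2r.
apply: (@leq_trans (N ^ (10 * N) * (N ^ 9 * N ^ 30))).
  by rewrite leq_mul2l leq_mul2r h !orbT.
by rewrite -!expnD leq_exp2l //; clear -N1; lia.
Qed.

End Main.

(** * The program *)

Lemma solution_finds w c sigma k S T : wf c ->
  wp w c T (solution S k) (nth 0 [:: size S; sigma; k]) (nth 0 S) ->
  exists2 t, t <= T & finds_min_attractor w (compile 0 c) sigma k S t.
Proof.
have cP : code_at (compile 0 c) 0 (compile 0 c).
  by exists [::], [::]; rewrite cats0.
move=> wfc /(_ wfc _ _ cP)[t [g [m [tT e _ _ [L [Ln cov mn g0 mL]]]]]]; exists t => //.
have [uL aL] := min_attractor_seq Ln cov mn.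
rewrite /finds_min_attractor /init e.
have -> : output (State (0 + size (compile 0 c)) g m) = map succn L.
  apply: (@eq_from_nth _ 0); first by rewrite /output /= !size_map size_iota g0.
  move=> i; rewrite /output /= size_map size_iota g0 => iL.
  by rewrite (nth_map 0) ?size_iota // nth_iota // (nth_map 0) // mL.
by split=> //; rewrite /halted /= add0n.
Qed.

Lemma init_agr sigma k (S : seq nat) :
  agr [:: (rn, size S); (rs, sigma); (rk, k)] (nth 0 [:: size S; sigma; k]).
Proof. by move=> [|[|[|x]]] v //= [<-]. Qed.

(** For [sigma = 1] the exponential term of the time bound is constant. Nothing is written to
    memory: the output is cell 0, whose content, the letter [S[1] = 1], is read as the position
    1. *)
Lemma main_unary w k S m g : 0 < size S -> 0 < k -> digits 1 S -> 2 < 2 ^ w ->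
  (forall a, m a = nth 0 S a) -> agr [:: (rn, size S); (rs, 1); (rk, k)] g ->
  wp w main_cmd (cost 0 main_cmd) (solution S k) g m.
Proof.
move=> n0 k0 dS w2 mS Eg.
have S1 i : i < size S -> nth 0 S i = 1 by move=> /(digits_nth dS); lia.
apply: (wpe_if Eg) => [||{Eg}g Eg _|//]; [by ok|by ok|].
apply: wpe_then; apply: (wpe_assign Eg) => [|{Eg}g Eg]; first by ok.
apply: (wpe_assign Eg) => [|{Eg}g Eg]; first by ok.
exists [:: 0]; split=> //=.
- by rewrite n0.
- move=> i l lk il; exists 0, 0; split=> //; first by lia.
  by move=> j jl; rewrite !S1 //; lia.
- move=> [|//] _ /(_ 0 0 k0 n0) [y [i' [] //]].
- by have [|_ ->] := Eg 0 1.
- by case=> // _; have [|_ ->] := Eg 1 0; rewrite // mS S1.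
Qed.

Lemma main_spec w sigma k S m g : 0 < size S -> 0 < k -> digits sigma S ->
  (size S).+1 ^ 7 <= 2 ^ w -> 1 < sigma -> sigma < 2 ^ w -> k < 2 ^ w ->
  (forall a, m a = nth 0 S a) -> agr [:: (rn, size S); (rs, sigma); (rk, k)] g ->
  wp w main_cmd (600 * size S + (sigma ^ k) ^ (49 * sigma ^ k)) (solution S k) g m.
Proof.
move=> n0 k0 dS nw s1 sw kw mS Eg.
have w2 : 2 < 2 ^ w by apply: leq_trans nw; rewrite (@leq_trans (2 ^ 7)) // leq_exp2r.
set T2 := cost (2 * size S) setup_cmd + (search_time S sigma k + cost (size S) output_cmd).
(* The test on [sigma] costs 4; the branch not taken is charged 0. *)
apply: (@wp_weaken _ _ (4 + (0 + T2)) _ (solution S k)) => //.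
  apply: wp_if => g' gg'; have Eg' := agr_same Eg gg'.
  rewrite (agr_sev Eg) ?(agr_sev Eg) //= ltnNge s1 /=.
  exact: solve_spec.
(* Neither the setup nor the output nests loops, so each is linear, with its code size as the
   factor. *)
have t1 : cost (2 * size S) setup_cmd <= 154 * (2 * size S).+1.
  exact: (cost_le _ setup_cmd).
have t2 : cost (size S) output_cmd <= 27 * (size S).+1 by exact: (cost_le _ output_cmd).
have t3 := search_time_le n0 k0 s1.
have le : sigma ^ minn k (size S) <= sigma ^ k by rewrite leq_exp2l // geq_minl.
have t4 : (sigma ^ minn k (size S)) ^ (49 * sigma ^ minn k (size S)) <=
    (sigma ^ k) ^ (49 * sigma ^ k).
  apply: leq_trans (leq_expn2r _ le) _.
  by rewrite leq_pexp2l ?expn_gt0 ?leq_mul2l ?le ?orbT // ltnW.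
rewrite /T2; lia.
Qed.

Lemma program_time n sigma k w S :
  1 <= n -> 1 <= k -> size S = n -> all (fun a => 1 <= a <= sigma) S ->
  7 * (trunc_log 2 n).+1 <= w -> sigma < 2 ^ w -> k < 2 ^ w ->
  exists2 t, t <= 600 * n + (sigma ^ k) ^ (49 * sigma ^ k)
    & finds_min_attractor w (compile 0 main_cmd) sigma k S t.
Proof.
move=> n0 k0 sS; subst n => dS tw sw kw.
have nw : (size S).+1 ^ 7 <= 2 ^ w.
  apply: leq_trans (_ : (2 ^ (trunc_log 2 (size S)).+1) ^ 7 <= _).
    by rewrite leq_exp2r // trunc_log_ltn.
  by rewrite -expnM leq_exp2l // mulnC.
apply: solution_finds => //.
have /andP[l1 l2] := digits_nth dS n0.
have [s1|s1] : sigma = 1 \/ 1 < sigma by lia.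
  subst sigma.
  have w2 : 2 < 2 ^ w by apply: leq_trans nw; rewrite (@leq_trans (2 ^ 7)) // leq_exp2r.
  have H := main_unary (m := nth 0 S) n0 k0 dS w2 (fun=> erefl) (@init_agr 1 k S).
  apply: wp_weaken H _ _ => //.
  apply: leq_trans (cost_le _ _) _; rewrite exp1n muln1.
  have : csize main_cmd <= 600 by [].
  by lia.
exact: main_spec (@init_agr sigma k S).
Qed.

Import Order.TTheory GRing.Theory Num.Theory.
Local Open Scope ring_scope.

Theorem theorem29 (R : realType) :
  exists (P : program) (c0 : nat) (c1 c2 : R),
    (0 < c0)%N /\
    forall (n sigma k w : nat) (S : seq nat),
      (1 <= n)%N -> (1 <= k)%N ->
      size S = n -> all (fun a => (1 <= a <= sigma)%N) S ->
      (c0 * (trunc_log 2 n).+1 <= w)%N ->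
      (sigma < 2 ^ w)%N -> (k < 2 ^ w)%N ->
      exists2 t : nat,
        t%:R <= c1 * n%:R +
                expR (c2 * ((sigma ^ k)%N%:R * ln (sigma ^ k)%N%:R))
        & finds_min_attractor w P sigma k S t.
Proof.
exists (compile 0 main_cmd), 7%N, 600%:R, 49%:R; split=> // n sigma k w S n1 k1 sS dS tw sw kw.
have [t tT ft] := program_time n1 k1 sS dS tw sw kw; exists t => //.
have N0 : (0 < sigma ^ k)%N.
  rewrite expn_gt0; apply/orP; left; rewrite -sS in n1.
  by have /andP[] := digits_nth dS n1; lia.
set N := (sigma ^ k)%N in tT N0 *.
have -> : expR (49%:R * (N%:R * ln N%:R)) = (N ^ (49 * N))%N%:R :> R.
  by rewrite mulrA -natrM expRM_natl lnK -?natrX // posrE ltr0n.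
by rewrite -natrM -natrD ler_nat.
Qed.
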